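(* Let $\mathscr{A},\mathscr{B}$ be two unital $C^*$-algebras, and let $\Phi:\mathscr{A}\to\mathscr{B}$ be a (not necessarily linear) continuous unital $3$-positive map in the class $S^{(2)}_{\mathrm{mon}+}$ with $\Phi(0)=0$. Then: (1) if $\Phi(\alpha I)=\alpha I$ for some $\alpha\in\mathbb{C}_1\cup\mathbb{R}_+$, then $\Phi(\alpha A)=\alpha\Phi(A)$ for every $A\in\mathscr{A}$; (2) if $\Phi(\alpha I)=\alpha I$ for some $\alpha\in\mathbb{C}_1\cup\mathbb{R}_+$ with $|\alpha|\neq 0,1$, then $\Phi(\beta A+B)=\beta\Phi(A)+\Phi(B)$ for every $\beta\in\mathbb{R}_+$ and all $A,B\in\mathscr{A}_+$.
   Context: Maps between $C^*$-algebras are arbitrary functions; linearity is not assumed. $\mathbb{C}_1$ is the closed unit ball of $\mathbb{C}$, $\mathbb{R}_+=[0,\infty)$, and $\mathscr{A}_+$ is the set of positive elements of $\mathscr{A}$. $\Phi$ is unital if $\Phi(I)=I$ (both units are denoted $I$). A map is positive if it sends positive elements to positive elements. For a map $\Phi:\mathscr{A}\to\mathscr{B}$ let $\Phi_n:M_n(\mathscr{A})\to M_n(\mathscr{B})$, $\Phi_n([a_{ij}])=[\Phi(a_{ij})]$, be the entrywise map. $\Phi$ is $n$-positive if $\Phi_n$ is positive. A positive map $\Phi$ is in the class $S^{(n)}_{\mathrm{mon}+}$ if $\Phi_n$ is monotone on positive elements of $M_n(\mathscr{A})$, i.e. $\Phi_n(X)\geq\Phi_n(Y)$ whenever $X\geq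 Y\geq 0$ in $M_n(\mathscr{A})$. Continuity is with respect to the norm topologies. *)

(* Defs.v *)
From HB Require Import structures.
From mathcomp Require Import all_boot all_order all_algebra.
From mathcomp Require Import complex.
From mathcomp Require Import all_classical all_reals all_analysis.

Set Implicit Arguments.
Unset Strict Implicit.
Unset Printing Implicit Defensive.

Import Order.TTheory GRing.Theory Num.Theory.
Import numFieldNormedType.Exports.

Local Open Scope classical_set_scope.
Local Open Scope ring_scope.
Local Open Scope complex_scope.

(** Unital complex C*-algebras. The scalars are [R[i]] for a real field [R];
    in a [completeNormedModType R[i]] the norm takes its values in [R[i]]
    (it is a nonnegative real there) and induces the topology.
    The library's hierarchy does not allow a structure to inherit both from
    rings and from normed modules (only its numerical domains do), so that the
    product is part of the mixin and the ring structure is declared after it.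
    The zero algebra is not excluded. *)
HB.mixin Record isCStarAlgebra (R : realType) A
    of CompleteNormedModule R[i] A := {
  cstar_one : A ;
  cstar_mul : A -> A -> A ;
  star : A -> A ;
  cstar_mulA : associative cstar_mul ;
  cstar_mul1r : left_id cstar_one cstar_mul ;
  cstar_mulr1 : right_id cstar_one cstar_mul ;
  cstar_mulDl : left_distributive cstar_mul +%R ;
  cstar_mulDr : right_distributive cstar_mul +%R ;
  cstar_scaleAl : forall (k : R[i]) (x y : A),
    k *: cstar_mul x y = cstar_mul (k *: x) y ;
  cstar_scaleAr : forall (k : R[i]) (x y : A),
    k *: cstar_mul x y = cstar_mul x (k *: y) ;
  starK : involutive star ;
  starD : {morph star : x y / x + y} ;
  starZ : forall (k : R[i]) (x : A), star (k *: x) = (k^*)%R *: star x ;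
  cstar_starM : forall x y : A,
    star (cstar_mul x y) = cstar_mul (star y) (star x) ;
  cstar_ler_normM : forall x y : A, `|cstar_mul x y| <= `|x| * `|y| ;
  cstar_normM : forall x : A, `|cstar_mul (star x) x| = `|x| ^+ 2
}.

#[short(type="cstarAlgType")]
HB.structure Definition CStarAlgebra (R : realType) :=
  {A of isCStarAlgebra R A & CompleteNormedModule R[i] A}.

HB.instance Definition _ (R : realType) (A : cstarAlgType R) :=
  GRing.Zmodule_isPzRing.Build (CStarAlgebra.sort A)
    (@cstar_mulA R A) (@cstar_mul1r R A) (@cstar_mulr1 R A)
    (@cstar_mulDl R A) (@cstar_mulDr R A).

Section Positivity.
Variables (R : realType) (S : pzRingType).
(* [sc] embeds the scalars in [S], and [st] is the involution of [S]. These
   are parameters because the library's module structure on ['M[A]_n] is over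
   [A], not over [R[i]]. *)
Variables (sc : R[i] -> S) (st : S -> S).

Definition invertible (x : S) : Prop := exists y, x * y = 1 /\ y * x = 1.

Definition spectrum (x : S) : set R[i] := [set l | ~ invertible (x - sc l)].

(* In [R[i]], [0 <= l] says that [l] is a nonnegative real number. *)
Definition is_positive (x : S) : Prop :=
  st x = x /\ spectrum x `<=` [set l | 0 <= l].

End Positivity.

Section CStar.
Variable R : realType.
Implicit Types A B : cstarAlgType R.

Definition positive A (a : A) : Prop :=
  is_positive (fun l : R[i] => l *: (1 : A)) (@star R A) a.

(* The positive elements of M_n(A) depend only on its structure of a unital
   *-algebra, so that its C*-norm is not needed here. *)
Definition mxstar A n (X : 'M[A]_n) : 'M[A]_n := \matrix_(i, j) star (X j i).

Definition mxpositive A n (X : 'M[A]_n) : Prop :=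
  is_positive (fun l : R[i] => (l *: (1 : A))%:M) (@mxstar A n) X.

Definition positive_map A B (Phi : A -> B) : Prop :=
  forall a, positive a -> positive (Phi a).

Definition n_positive A B n (Phi : A -> B) : Prop :=
  forall X : 'M[A]_n, mxpositive X -> mxpositive (map_mx Phi X).

(* The class S^(n)_mon+. *)
Definition Smonp A B n (Phi : A -> B) : Prop :=
  positive_map Phi /\
  forall X Y : 'M[A]_n, mxpositive (X - Y) -> mxpositive Y ->
    mxpositive (map_mx Phi X - map_mx Phi Y).

End CStar.

(* Main.v *)
Require Import Defs.
From mathcomp Require Import all_boot all_order all_algebra.
From mathcomp Require Import complex ring lra.
From mathcomp Require Import all_classical all_reals all_analysis.

Import Order.TTheory GRing.Theory Num.Theory.
Import numFieldNormedType.Exports.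

Local Open Scope classical_set_scope.
Local Open Scope ring_scope.
Local Open Scope complex_scope.

Set Implicit Arguments.
Unset Strict Implicit.
Unset Printing Implicit Defensive.

(** The proof has two parts, one on positivity and one on the map.

    Positivity. Since the entrywise maps are tested on matrices, positivity in
    M_n(A) has to be understood from positivity in A, and no C*-norm on M_n(A)
    is used for this. In A, [cone] is the set of self-adjoint [a] such that, for
    every [e > 0], [|t - a| <= t + e] for some [t >= 0]. It is visibly a closed
    convex cone, Neumann series show that [a + c] is invertible for [a] in the
    cone and [c > 0], and squares of self-adjoint elements belong to it
    ([cone_square]). Conversely, let [x] be self-adjoint with [x + c] invertible
    for all [c > 0]: the least [l >= 0] for which [x + l] is in the cone must be
    [0], because an invertible element of the cone dominates a positive scalar
    ([cone_of_spectrum]). This last argument only uses a few properties of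
    the cone, so it is done in an abstract ring with involution and yields
    [is_positiveP]: positivity, defined by the spectrum, is membership in the
    cone. It is applied to A ([positiveP]), where it leads to Kaplansky's theorem
    that [star x * x] is positive ([cone_starM]), and then to M_n(A) with the
    cone of the matrices [X] such that [v^* X v] is positive for every column
    [v] ([mxpositiveP]); there the resolvents are built by Schur complements
    ([coercive_invertible]).

    The map. Write [f t] for [Phi (t 1)]. If [Phi] fixes [c 1] and [|c|^2 1],
    apply it to the positive 3 x 3 matrix with entries [star g_i * g_j], where
    [g = (1, c^*, a)]. The upper left 2 x 2 block of the image is singular and
    this forces [Phi (c a) = c Phi a] ([Phi_scale_of_fixed]). The matrices
    [a + v_i v_j b] with [v = (0, p, q)] are positive too; comparing the last two
    rows and columns of the image with the first ones shows that the slope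
    [(Phi (a + t b) - Phi a) / t] is a midpoint convex function of [log t]
    ([slope_log_convex]). A convex sequence that is bounded above decreases, so
    bounded slopes decrease along every geometric progression [t, t s, t s ^ 2, ...];
    bounded slopes on all of the half-line are constant, as [s] may be inverted.
    Monotonicity of [Phi_2] makes [Phi] superadditive on positive elements
    ([Phi_superadditive]), which provides the upper bounds.

    For [a = 0] and [b = 1] the slope is [f t / t], at most [2] for [t <= 1].
    If [Phi] fixes [alpha 1] with [|alpha|] different from [0] and [1], then
    [f r / r >= 1] for [r = |alpha|] or [r = 1 / |alpha|], whichever is less than
    [1], and the decrease along [1, r, ...] forces [f r = r] and [f (r ^ 2) = r ^ 2]. Hence [Phi]
    commutes with multiplication by [r], the slope [f t / t] is bounded for all
    [t > 0], and it is constant: [f t = t] and [Phi] is positively homogeneous.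
    For positive [a >= d b], superadditivity and homogeneity bound the slopes of
    [t |-> Phi (a + t b)] for all [t > 0], so [Phi] is affine along this ray; the
    behaviour at infinity identifies the slope with [Phi b]
    ([Phi_additive_dominated]). Continuity removes the condition [a >= d b]. *)

(** * Deciding linear identities in a module *)

(** Both sides of a linear identity are reified over a list of atoms, so that
    the identity reduces to equalities of coefficients in the ground ring. *)
Section LinearExpressions.
Variables (K : pzRingType) (V : lmodType K).

Inductive lexpr : Type :=
  | LVar of nat
  | LZero
  | LAdd of lexpr & lexpr
  | LOpp of lexpr
  | LScale of K & lexpr.

Fixpoint leval (env : seq V) (e : lexpr) : V :=
  match e with
  | LVar i => env`_i
  | LZero => 0
  | LAdd e1 e2 => leval env e1 + leval env e2
  | LOpp e1 => - leval env e1
  | LScale c e1 => c *: leval env e1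
  end.

Fixpoint lcoef (e : lexpr) (i : nat) : K :=
  match e with
  | LVar j => if Nat.eqb i j then 1 else 0
  | LZero => 0
  | LAdd e1 e2 => lcoef e1 i + lcoef e2 i
  | LOpp e1 => - lcoef e1 i
  | LScale c e1 => c * lcoef e1 i
  end.

Lemma leval_sum env e :
  leval env e = \sum_(i < size env) lcoef e i *: env`_i.
Proof.
elim: e => [j||e1 IH1 e2 IH2|e1 IH1|c e1 IH1] /=.
- have [lt_j|le_j] := ltnP j (size env); last first.
    rewrite nth_default // big1 // => i _.
    case: (PeanoNat.Nat.eqb_spec i j) => [eij|_]; last by rewrite scale0r.
    by move: (ltn_ord i); rewrite eij ltnNge le_j.
  rewrite (bigD1 (Ordinal lt_j)) //= PeanoNat.Nat.eqb_refl scale1r big1 ?addr0 //.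
  move=> i /eqP neq; case: (PeanoNat.Nat.eqb_spec i j) => [eij|_].
    by case: neq; apply: val_inj.
  by rewrite scale0r.
- by rewrite big1 // => i _; rewrite scale0r.
- by rewrite IH1 IH2 -big_split /=; apply: eq_bigr => i _; rewrite scalerDl.
- by rewrite IH1 -sumrN; apply: eq_bigr => i _; rewrite scaleNr.
- by rewrite IH1 scaler_sumr; apply: eq_bigr => i _; rewrite scalerA.
Qed.

Fixpoint same_coefs (n : nat) (e1 e2 : lexpr) : Prop :=
  match n with
  | 0%N => True
  | n'.+1 => lcoef e1 n' = lcoef e2 n' /\ same_coefs n' e1 e2
  end.

Lemma leval_eq env e1 e2 :
  same_coefs (size env) e1 e2 -> leval env e1 = leval env e2.
Proof.
rewrite !leval_sum => h; apply: eq_bigr => i _; congr (_ *: _).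
elim: (size env) i h => [[]//|n IH] i /= [hn h].
have [ni|ni] := eqVneq (i : nat) n; first by rewrite ni.
have lt_i : (i < n)%N by rewrite ltn_neqAle ni -ltnS ltn_ord.
exact: (IH (Ordinal lt_i) h).
Qed.

End LinearExpressions.


(** Atoms are compared up to conversion, because the same element of a C*-algebra
    is met through the ring structure and through the module structure. *)
Ltac lindex x env :=
  match env with
  | ?y :: _ => let _ := match goal with _ => unify x y end in constr:(0%N)
  | _ :: ?env' => let i := lindex x env' in constr:(i.+1)
  end.

Ltac latoms K x env :=
  lazymatch x with
  | (?a + ?b)%R => let env' := latoms K a env in latoms K b env'
  | (- ?a)%R => latoms K a env
  | (_ *: ?a)%R => latoms K a env
  | 0%R => env
  | _ => match env with
         | _ => let _ := lindex x env in env
         | _ => constr:(x :: env)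
         end
  end.

Ltac lreify K x env :=
  lazymatch x with
  | (?a + ?b)%R =>
      let e1 := lreify K a env in let e2 := lreify K b env in
      constr:(@LAdd K e1 e2)
  | (- ?a)%R => let e := lreify K a env in constr:(@LOpp K e)
  | (?c *: ?a)%R => let e := lreify K a env in constr:(@LScale K c e)
  | 0%R => constr:(@LZero K)
  | _ => let i := lindex x env in constr:(@LVar K i)
  end.

Ltac module_with tac :=
  match goal with
  | |- @eq ?V0 ?x ?y =>
    let R := match goal with R : realType |- _ => R end in
    let K := constr:(R[i] : pzRingType) in
    let V := constr:(V0 : lmodType R[i]) in
    let env0 := latoms K x (@nil V0) in
    let env := latoms K y env0 in
    let e1 := lreify K x env in
    let e2 := lreify K y env in
    change (@leval K V env e1 = @leval K V env e2);
    apply: leval_eq; cbn [same_coefs lcoef size Nat.eqb];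
    repeat (split; [tac|]); exact I
  end.

Ltac module_ring := module_with ltac:(ring).

Ltac module_field :=
  module_with ltac:(field; rewrite ?fmorph_eq0 ?pnatr_eq0 //=;
                    repeat (apply/andP; split); by []).

(** * The real-valued norm, and fixed points of contractions *)
Section Norm.
Variables (R : realType) (A : cstarAlgType R).
Implicit Types (a b x y z : A) (e q s t K : R).

(** The norm [`|a|] is a nonnegative real lying in the partially ordered field
    [R[i]]; norms are compared in the totally ordered field [R] instead. *)
Definition nr a : R := complex.Re `|a|.

Lemma nrE a : `|a| = (nr a)%:C.
Proof. by rewrite /nr RRe_real // normr_real. Qed.

Lemma nr_ge0 a : 0 <= nr a.
Proof. by rewrite -lecR -nrE normr_ge0. Qed.

Lemma nr0_eq0 a : nr a = 0 -> a = 0.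
Proof. by move=> a0; apply: normr0_eq0; rewrite nrE a0. Qed.

Lemma nr0 : nr 0 = 0.
Proof. by apply: complexI; rewrite -nrE normr0. Qed.

Lemma nrN a : nr (- a) = nr a.
Proof. by rewrite /nr normrN. Qed.

Lemma nrB a b : nr (a - b) = nr (b - a).
Proof. by rewrite -nrN opprB. Qed.

Lemma nrD a b : nr (a + b) <= nr a + nr b.
Proof. by rewrite -lecR rmorphD /= -!nrE ler_normD. Qed.

Lemma nr_triangle a b x : nr (a - b) <= nr (a - x) + nr (x - b).
Proof. by have := nrD (a - x) (x - b); rewrite addrA subrK. Qed.

Lemma normC_real t : `|t%:C| = `|t|%:C :> R[i].
Proof.
have [t0|t0] := leP 0 t; first by rewrite !ger0_norm // ler0c.
have tC : t%:C <= 0 by rewrite -[0]/(0%:C) lecR ltW.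
by rewrite (ler0_norm tC) (ltr0_norm t0) rmorphN.
Qed.

Lemma nrZC (c : R[i]) a : nr (c *: a) = complex.Re `|c| * nr a.
Proof.
apply: complexI; rewrite rmorphM -!nrE /= normrZ; congr (_ * _).
by rewrite RRe_real // normr_real.
Qed.

Lemma nrZ t a : nr (t%:C *: a) = `|t| * nr a.
Proof. by rewrite nrZC normC_real. Qed.

Lemma nrZ_ge0 t a : 0 <= t -> nr (t%:C *: a) = t * nr a.
Proof. by move=> t0; rewrite nrZ ger0_norm. Qed.

Lemma nrM a b : nr (a * b) <= nr a * nr b.
Proof. by rewrite -lecR rmorphM /= -!nrE; apply: cstar_ler_normM. Qed.

Lemma nr_starM a : nr (star a * a) = nr a ^+ 2.
Proof. by apply: complexI; rewrite rmorphXn /= -!nrE; apply: cstar_normM. Qed.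

Lemma nr_star a : nr (star a) = nr a.
Proof.
have le_star x : nr x <= nr (star x).
  have [x0|x0] := eqVneq (nr x) 0; first by rewrite x0 nr_ge0.
  have xp : 0 < nr x by rewrite lt_def x0 nr_ge0.
  by rewrite -(ler_pM2r xp) -expr2 -nr_starM nrM.
by apply/eqP; rewrite eq_le le_star andbT -{2}[a]starK le_star.
Qed.

Lemma nr_eq0_small z K :
  0 <= K -> (forall e, 0 < e -> nr z <= K * e) -> z = 0.
Proof.
move=> K0 small; apply: nr0_eq0; apply/eqP.
rewrite eq_le nr_ge0 andbT; apply/ler_addgt0Pr => e e0; rewrite add0r.
have K1 : 0 < K + 1 by lra.
apply: le_trans (small (e / (K + 1)) _) _; first by rewrite divr_gt0.
by rewrite mulrCA ger_pMr // ler_pdivrMr // mul1r; lra.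
Qed.

Lemma scale_mull (c : R[i]) a b : (c *: a) * b = c *: (a * b).
Proof. exact/esym/cstar_scaleAl. Qed.

Lemma scale_mulr (c : R[i]) a b : a * (c *: b) = c *: (a * b).
Proof. exact/esym/cstar_scaleAr. Qed.

Lemma starM a b : star (a * b) = star b * star a.
Proof. exact: cstar_starM. Qed.

Lemma star0 : star (0 : A) = 0.
Proof. by apply: (addIr (star 0)); rewrite -starD !add0r. Qed.

Lemma starN a : star (- a) = - star a.
Proof. by apply: (addIr (star a)); rewrite -starD !addNr star0. Qed.

Lemma starZr t a : star (t%:C *: a) = t%:C *: star a.
Proof.
rewrite starZ; congr (_ *: _); apply: conj_Creal.
by rewrite complex_real.
Qed.

Lemma star1 : star (1 : A) = 1.
Proof. by rewrite -[LHS]mul1r -{1}[1]starK -starM mul1r starK. Qed.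

Lemma nr1_le1 : nr (1 : A) <= 1.
Proof.
have := nr_starM 1; rewrite star1 mul1r expr2 => n1.
have [n0|n0] := eqVneq (nr (1 : A)) 0; first by rewrite n0 ler01.
by move/(congr1 (fun t => t / nr (1 : A))): n1; rewrite mulfK // divff // => ->.
Qed.

Lemma nr_scalar t : 0 <= t -> nr (t%:C *: (1 : A)) <= t.
Proof. by move=> t0; rewrite nrZ_ge0 // ler_piMr // nr1_le1. Qed.

Lemma exists_geometric_le (K q e : R) :
  0 <= q < 1 -> 0 < e -> exists n, K * q ^+ n <= e.
Proof.
move=> /andP[q0 q1] e0.
have nq : `|q| < 1 by rewrite ger0_norm.
have /cvgrPdist_le /(_ e e0) [N _ hN] : (fun n => K * q ^+ n) @ \oo --> K * 0.
  by apply: cvgMr; apply: cvg_expr.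
exists N; have := hN N (leqnn N); rewrite /= mulr0 sub0r normrN.
exact: le_trans (ler_norm _).
Qed.

Lemma geometric_cvg (u : nat -> A) (K q : R) :
  0 <= q < 1 -> (forall n, nr (u n.+1 - u n) <= K * q ^+ n) ->
  exists l, forall e, 0 < e ->
    exists N, forall n, (N <= n)%N -> nr (u n - l) <= e.
Proof.
move=> /[dup] q01 /andP[q0 q1] hu.
have d0 : 0 < 1 - q by lra.
have K0 : 0 <= K by have := le_trans (nr_ge0 _) (hu 0%N); rewrite expr0 mulr1.
have tail n k : nr (u (n + k)%N - u n) <= K / (1 - q) * q ^+ n * (1 - q ^+ k).
  elim: k => [|k IH]; first by rewrite addn0 subrr nr0 expr0 subrr mulr0.
  rewrite addnS; apply: le_trans (nr_triangle _ _ (u (n + k)%N)) _.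
  apply: le_trans (lerD (hu _) IH) _; rewrite exprD exprS.
  by rewrite le_eqVlt; apply/orP; left; apply/eqP; field; rewrite gt_eqF.
have tail' n m : (n <= m)%N -> nr (u m - u n) <= K / (1 - q) * q ^+ n.
  move=> /subnKC <-; apply: le_trans (tail _ _) _.
  rewrite ler_piMr //; first by rewrite mulr_ge0 ?exprn_ge0 // divr_ge0 // ltW.
  by have := exprn_ge0 (m - n)%N q0; lra.
have : cvg (u @ \oo).
  apply/cauchy_cvgP; apply: cauchy_exP => _/posnumP[e].
  have e0 : 0 < e%:num by [].
  have er : e%:num = (complex.Re e%:num)%:C.
    by rewrite RRe_real // ger0_real.
  have e0' : 0 < complex.Re e%:num by rewrite -ltcR -er.
  have e2 : 0 < complex.Re e%:num / 2 by rewrite divr_gt0.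
  have [N hN] := exists_geometric_le (K / (1 - q)) q01 e2.
  exists (u N); exists N => // m /= Nm.
  rewrite -ball_normE /ball_ /= distrC er nrE ltcR.
  by apply: le_lt_trans (le_trans (tail' _ _ Nm) hN) _; lra.
move=> /cvg_ex [l /cvgrPdist_le ul]; exists l => e e0.
have e0C : 0 < e%:C :> R[i] by rewrite -[0]/(0%:C) ltcR.
have [N _ hN] := ul _ e0C; exists N => n Nn.
by have := hN n Nn; rewrite /= nrE lecR nrB.
Qed.

(** Banach's fixed point theorem on a closed set [D], the only use of
    completeness: it produces inverses (Neumann series) and square roots. *)
Lemma contraction_fixpoint (D : A -> Prop) (F : A -> A) (q : R) (x0 : A) :
  0 <= q < 1 -> D x0 -> (forall x, D x -> D (F x)) ->
  (forall x y, D x -> D y -> nr (F x - F y) <= q * nr (x - y)) ->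
  (forall l, (forall e, 0 < e -> exists x, D x /\ nr (x - l) <= e) -> D l) ->
  exists l, D l /\ F l = l.
Proof.
move=> q01 Dx0 DF contr closD.
pose u n := iter n F x0.
have Du n : D (u n) by elim: n => //= n; apply: DF.
have hu n : nr (u n.+1 - u n) <= nr (F x0 - x0) * q ^+ n.
  elim: n => [|n IH]; first by rewrite expr0 mulr1.
  have := contr _ _ (Du n.+1) (Du n); move=> /le_trans; apply.
  by rewrite exprS mulrCA ler_wpM2l //; case/andP: q01.
have [l ul] := geometric_cvg q01 hu.
have Dl : D l.
  by apply: closD => e /ul[N hN]; exists (u N); split; rewrite ?hN.
exists l; split=> //; apply/eqP; rewrite -subr_eq0; apply/eqP.
apply: (@nr_eq0_small _ 2) => // e e0; have [N hN] := ul _ e0.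
apply: le_trans (nr_triangle _ _ (u N.+1)) _; rewrite /=.
have := hN N.+1 (leqnSn N); have := hN N (leqnn N) => h1 h2.
have := contr _ _ Dl (Du N); rewrite [nr (l - _)]nrB => h3.
have q1 : q * nr (u N - l) <= nr (u N - l).
  by rewrite ler_piMl ?nr_ge0 //; case/andP: q01 => _ /ltW.
by move: h2 => /=; lra.
Qed.

End Norm.

(** [lra] after identifying the norms of convertible elements, for the same
    reason as in [lindex]. *)
Ltac nr_lra :=
  repeat match goal with H : is_true (_ <= _) |- _ => move: H
                       | H : is_true (_ < _) |- _ => move: H end;
  repeat match goal with |- context [nr ?x] =>
    repeat match goal with |- context [nr ?y] =>
      tryif constr_eq x y then fail else (unify x y; change (nr y) with (nr x))
    end;
    move: (nr x) => ?
  end; move=> *; lra.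


(** * The norm cone *)
Section Cone.
Variables (R : realType) (A : cstarAlgType R).
Implicit Types (a b x y z u v : A) (s t c d e : R).
Local Notation scal t := (t%:C *: (1 : A)).

Lemma invertibleZ t x :
  t != 0 -> invertible x -> invertible (t%:C *: x).
Proof.
move=> t0 [y [xy yx]]; exists ((t^-1)%:C *: y).
rewrite !scale_mull !scale_mulr !scalerA xy yx -!rmorphM.
by rewrite divff // mulVf // scale1r.
Qed.

Lemma neumann x : nr x < 1 -> invertible (1 - x).
Proof.
move=> x1; have q01 : 0 <= nr x < 1 by rewrite nr_ge0.
(* The two fixed points are a right and a left inverse of [1 - x]. *)
have [y [_ yE]] : exists l, True /\ 1 + x * l = l.
  apply: (contraction_fixpoint (D := fun=> True) (x0 := 0) q01) => // y1 y2 _ _.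
  by rewrite [1 + _]addrC opprD addrA addrK -mulrBr nrM.
have [z [_ zE]] : exists l, True /\ 1 + l * x = l.
  apply: (contraction_fixpoint (D := fun=> True) (x0 := 0) q01) => // z1 z2 _ _.
  by rewrite [1 + _]addrC opprD addrA addrK -mulrBl mulrC nrM.
have y1 : (1 - x) * y = 1 by rewrite mulrBl mul1r -{1}yE addrK.
have z1 : z * (1 - x) = 1 by rewrite mulrBr mulr1 -{1}zE addrK.
by exists y; split=> //; rewrite -[y]mul1r -{1}z1 -mulrA y1 mulr1.
Qed.

Lemma invertible_scalarB t x : nr x < t -> invertible (scal t - x).
Proof.
move=> xt; have t0 : 0 < t by apply: le_lt_trans xt; apply: nr_ge0.
have tn : t != 0 by rewrite gt_eqF.
have -> : scal t - x = t%:C *: (1 - (t^-1)%:C *: x) by module_field.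
apply: invertibleZ => //; apply: neumann.
by rewrite nrZ_ge0 ?invr_ge0 ?ltW // mulrC ltr_pdivrMr // mul1r.
Qed.

(** The norm of [u + 'i v] is squared by the C*-identity to that of
    [u ^ 2 + v ^ 2], and [u] is its real part. *)
Lemma nr_le_sum_squares u v : star u = u -> star v = v -> u * v = v * u ->
  nr u ^+ 2 <= nr (u * u + v * v).
Proof.
move=> su sv uv.
have [i [ii ic]] : exists i : R[i], i * i = -1 /\ (i^*)%R = - i.
  by exists 'i%R; rewrite -expr2 sqrCi conjCi.
pose w := u + i *: v.
have sw : star w = u - i *: v by rewrite starD starZ su sv ic scaleNr.
have iiv : i *: (i *: (v * v)) = - (v * v) by rewrite scalerA ii scaleN1r.
have -> : u * u + v * v = star w * w.
  by rewrite sw /w mulrBl !mulrDr !scale_mull !scale_mulr uv iiv; module_ring.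
rewrite nr_starM ler_sqr ?nnegrE ?nr_ge0 //.
have uE : u = (2^-1)%:C *: (w + star w) by rewrite sw /w; module_field.
rewrite {1}uE nrZ_ge0 ?invr_ge0 //; have := nrD w (star w); rewrite nr_star.
by lra.
Qed.

(** In a nonzero algebra the infimum of [|t - a| - t] over [t >= 0] is minus the
    least spectral value of the self-adjoint [a]; the cone asks for a nonpositive
    infimum. Since [t] is not bounded in terms of [|a|], sums and limits are
    immediate. *)
Definition cone a : Prop :=
  star a = a /\
  forall e, 0 < e -> exists t, 0 <= t /\ nr (scal t - a) <= t + e.

Lemma cone_sa a : cone a -> star a = a. Proof. by case. Qed.

Lemma star_scalar t : star (scal t) = scal t.
Proof. by rewrite starZr star1. Qed.

Lemma cone_scalar t : 0 <= t -> cone (scal t).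
Proof.
move=> t0; split; first exact: star_scalar.
by move=> e e0; exists t; split=> //; rewrite subrr nr0; lra.
Qed.

Lemma coneD a b : cone a -> cone b -> cone (a + b).
Proof.
move=> [sa ha] [sb hb]; split; first by rewrite starD sa sb.
move=> e e0; have e2 : 0 < e / 2 by lra.
have [t [t0 ht]] := ha _ e2; have [s [s0 hs]] := hb _ e2.
exists (t + s); split; first by lra.
have -> : scal (t + s) - (a + b) = (scal t - a) + (scal s - b).
  by module_ring.
by have := nrD (scal t - a) (scal s - b); lra.
Qed.

Lemma coneZ c a : 0 <= c -> cone a -> cone (c%:C *: a).
Proof.
move=> c0 [sa ha]; split; first by rewrite starZr sa.
move=> e e0; have d0 : 0 < e / (c + 1) by rewrite divr_gt0 //; lra.
have [t [t0 ht]] := ha _ d0; exists (c * t); split; first by rewrite mulr_ge0.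
have -> : scal (c * t) - c%:C *: a = c%:C *: (scal t - a) by module_ring.
rewrite nrZ_ge0 //; apply: le_trans (ler_wpM2l c0 ht) _.
rewrite mulrDr lerD2l mulrCA ger_pMr // ler_pdivrMr ?mul1r; lra.
Qed.

Lemma cone_closed a : star a = a ->
  (forall d, 0 < d -> exists b, cone b /\ nr (a - b) <= d) -> cone a.
Proof.
move=> sa ha; split=> // e e0; have e2 : 0 < e / 2 by lra.
have [b [[_ hb] ab]] := ha _ e2; have [t [t0 ht]] := hb _ e2.
exists t; split=> //; apply: le_trans (nr_triangle _ _ b) _.
by move: ab; rewrite nrB; lra.
Qed.

Lemma cone_arch a : (forall e, 0 < e -> cone (a + scal e)) -> cone a.
Proof.
move=> ha; apply: cone_closed.
  by have := cone_sa (ha 1 ltr01); rewrite starD star_scalar => /addIr.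
move=> d d0; exists (a + scal d); split; first exact: ha.
by rewrite opprD addrA subrr add0r nrN nr_scalar // ltW.
Qed.

Lemma cone_nr_sub a t : star a = a -> nr a <= t -> cone (scal t - a).
Proof.
move=> sa nt; split; first by rewrite starD starN star_scalar sa.
move=> e e0; exists t; split; first exact: le_trans (nr_ge0 a) nt.
by rewrite subKr; lra.
Qed.

(** Here [a + c] is [T - x] with [|x| < T], a Neumann series. *)
Lemma cone_invertible a c : cone a -> 0 < c -> invertible (a + scal c).
Proof.
move=> [sa ha] c0; have c2 : 0 < c / 2 by lra.
have [t [t0 ht]] := ha _ c2.
have -> : a + scal c = scal (t + c) - (scal t - a) by module_ring.
by apply: invertible_scalarB; lra.
Qed.

(** The second-order Taylor polynomial [p] of [exp ('i x)] satisfies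
    [star p * p = 1 + x ^ 4 / 4], and its real part is [1 - x ^ 2 / 2]. *)
Lemma cone_square a : star a = a -> cone (a * a).
Proof.
move=> sa; split; first by rewrite starM sa.
move=> e e0; set N := nr a ^+ 4.
have N0 : 0 <= N by rewrite exprn_ge0 // nr_ge0.
have N1 : 0 < N + 1 by lra.
(* [x = s a] with [s] so small that the error [N s ^ 2 / 4] is at most [e]. *)
pose s := Num.min 1 (e / (N + 1)).
have s0 : 0 < s by rewrite lt_min ltr01 divr_gt0.
have s1 : s <= 1 by rewrite ge_min lexx.
have sN : N * s <= e.
  apply: le_trans (_ : (N + 1) * s <= e); first by lra.
  by rewrite mulrC -ler_pdivlMr // ge_min lexx orbT.
have [x xE] : exists x, x = s%:C *: a by exists (s%:C *: a).
pose u := 1 - (2^-1)%:C *: (x * x).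
have sx : star x = x by rewrite xE starZr sa.
have su : star u = u by rewrite starD starN starZr starM sx star1.
have xxx : x * (x * x) = x * x * x by rewrite mulrA.
have ux : u * x = x * u.
  by rewrite mulrBl mulrBr mul1r mulr1 scale_mull scale_mulr mulrA.
have uuxx : u * u + x * x = 1 + (4^-1)%:C *: (x * x * (x * x)).
  by rewrite mulrBl !mulrBr !(mul1r, mulr1) !scale_mull !scale_mulr; module_field.
have nx : nr x = s * nr a by rewrite xE nrZ_ge0 // ltW.
have nu2 : nr u ^+ 2 <= 1 + 4^-1 * (s ^+ 4 * N).
  apply: le_trans (nr_le_sum_squares su sx ux) _; rewrite uuxx.
  apply: le_trans (nrD _ _) _; apply: lerD; first exact: nr1_le1.
  rewrite nrZ_ge0 // ler_pM2l //; apply: le_trans (nrM _ _) _.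
  have x2 : nr (x * x) = (s * nr a) ^+ 2 by rewrite -{1}sx nr_starM nx.
  by rewrite x2 /N; rewrite le_eqVlt; apply/orP; left; apply/eqP; ring.
have nu : nr u <= 1 + 8^-1 * (s ^+ 4 * N).
  have s4 : 0 <= s ^+ 4 * N by rewrite mulr_ge0 // exprn_ge0 // ltW.
  rewrite -ler_sqr ?nnegrE ?nr_ge0 //; last by lra.
  by apply: le_trans nu2 _; nra.
exists (2 / s ^+ 2); split; first by rewrite divr_ge0 // exprn_ge0 // ltW.
have sn : s != 0 by rewrite gt_eqF.
have -> : scal (2 / s ^+ 2) - a * a = (2 / s ^+ 2)%:C *: u.
  by rewrite /u xE scale_mull scale_mulr; module_field.
rewrite nrZ_ge0; last by rewrite divr_ge0 // exprn_ge0 // ltW.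
have s2 : 0 <= 2 / s ^+ 2 by rewrite divr_ge0 // exprn_ge0 // ltW.
apply: le_trans (ler_wpM2l s2 nu) _.
have -> : 2 / s ^+ 2 * (1 + 8^-1 * (s ^+ 4 * N)) =
          2 / s ^+ 2 + 4^-1 * s * (N * s) by field.
by rewrite lerD2l; nra.
Qed.

End Cone.

(** * Square roots and the order *)
Section SquareRoot.
Variables (R : realType) (A : cstarAlgType R).
Implicit Types (a b x y z u v : A) (s t c d e q : R).
Local Notation scal t := (t%:C *: (1 : A)).

Lemma scal_mul t x : scal t * x = t%:C *: x.
Proof. by rewrite scale_mull mul1r. Qed.

Lemma mul_scal t x : x * scal t = t%:C *: x.
Proof. by rewrite scale_mulr mulr1. Qed.

(** Up to a positive factor [a + c] is [1 - x] with [|x| < 1], and [1 - y] is a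
    square root of [1 - x] as soon as [y = (x + y ^ 2) / 2], a contraction of the
    ball of radius [|x|]. The contraction preserves the commutant of [x], hence so
    does its fixed point. *)
Lemma cone_sqrt a c : cone a -> 0 < c ->
  exists r, [/\ cone r, r * r = a + scal c &
                forall h, h * a = a * h -> h * r = r * h].
Proof.
move=> [sa ha] c0; have c2 : 0 < c / 2 by lra.
have [t [t0 ht]] := ha _ c2; set T := t + c.
have T0 : 0 < T by rewrite /T; nr_lra.
have Tn : T != 0 by rewrite gt_eqF.
have [x xE] : exists x, x = (T^-1)%:C *: (scal t - a).
  by exists ((T^-1)%:C *: (scal t - a)).
have sx : star x = x by rewrite xE starZr starD starN star_scalar sa.
have x1 : nr x < 1.
  rewrite xE nrZ_ge0 ?invr_ge0 ?ltW // mulrC ltr_pdivrMr // mul1r.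
  by apply: le_lt_trans ht _; rewrite /T; nr_lra.
have x0 := nr_ge0 x; have q01 : 0 <= nr x < 1 by rewrite x0.
pose D y := [/\ star y = y, nr y <= nr x &
                forall h, h * x = x * h -> h * y = y * h].
have [y [[sy ny cy] yE]] : exists y, D y /\ (2^-1)%:C *: (x + y * y) = y.
  apply: (contraction_fixpoint (D := D) (x0 := 0) q01).
  - by split=> [||h _]; rewrite ?star0 ?nr0 ?mulr0 ?mul0r.
  - move=> y [sy ny cy]; split.
    + by rewrite starZr starD starM sx sy.
    + rewrite nrZ_ge0 ?invr_ge0 //; have := nrD x (y * y); have := nrM y y.
      by have := nr_ge0 y; nra.
    + move=> h hx; have hy := cy h hx.
      by rewrite scale_mull scale_mulr mulrDl mulrDr hx mulrA hy -!mulrA hy.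
  - move=> y z [_ ny _] [_ nz _].
    rewrite [X in nr X](_ : _ = (2^-1)%:C *: (y * (y - z) + (y - z) * z));
      last by rewrite mulrBl mulrBr; module_ring.
    rewrite nrZ_ge0 ?invr_ge0 //.
    have := nrD (y * (y - z)) ((y - z) * z); have := nrM y (y - z).
    have := nrM (y - z) z; have d0 := nr_ge0 (y - z).
    have := ler_wpM2l d0 nz; have := ler_wpM2r d0 ny.  nr_lra.
  - move=> l hl; split.
    + apply/eqP; rewrite -subr_eq0; apply/eqP.
      apply: (@nr_eq0_small _ _ _ 2) => // e /hl [y [[sy _ _] yl]].
      rewrite [X in nr X](_ : _ = star (l - y) + (y - l)); last first.
        by rewrite starD starN sy; module_ring.
      by have := nrD (star (l - y)) (y - l); rewrite nr_star [nr (l - y)]nrB; nr_lra.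
    + apply/ler_addgt0Pr => e /hl [y [[_ ny _] yl]].
      by have := nrD (l - y) y; rewrite subrK [nr (l - y)]nrB; nr_lra.
    + move=> h hx; apply/eqP; rewrite -subr_eq0; apply/eqP.
      apply: (@nr_eq0_small _ _ _ (2 * nr h)); first by rewrite mulr_ge0 ?nr_ge0.
      move=> e /hl [y [[_ _ cy] yl]].
      rewrite [X in nr X](_ : _ = (y - l) * h + h * (l - y)); last first.
        by rewrite mulrBl mulrBr cy //; module_ring.
      have := nrD ((y - l) * h) (h * (l - y)); have := nrM (y - l) h.
      have := nrM h (l - y); rewrite [nr (l - y)]nrB.
      have := ler_wpM2l (nr_ge0 h) yl; nr_lra.
have T00 := ltW T0.
exists ((Num.sqrt T)%:C *: (1 - y)); split.
- split; first by rewrite starZr starD starN star1 sy.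
  move=> e e0; exists (Num.sqrt T); split; first exact: sqrtr_ge0.
  rewrite [X in nr X](_ : _ = (Num.sqrt T)%:C *: y); last by module_ring.
  rewrite nrZ_ge0 ?sqrtr_ge0 //; have := sqrtr_ge0 T.
  move=> sT; have := ler_wpM2l sT ny; have := ler_wpM2l sT (ltW x1); nr_lra.
- rewrite scale_mull scale_mulr scalerA -rmorphM -expr2 sqr_sqrtr //=.
  have -> : (1 - y) * (1 - y) = 1 - x.
    have yy : y * y = 2%:C *: y - x by rewrite -{3}yE; module_field.
    by rewrite mulrBl !mulrBr !mul1r !mulr1 yy; module_ring.
  have -> : a + scal c = scal T - (scal t - a) by rewrite /T; module_ring.
  by rewrite xE; module_field.
- move=> h hx; rewrite scale_mull scale_mulr mulrBl mulrBr mul1r mulr1 cy //.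
  by rewrite xE scale_mull scale_mulr mulrBl mulrBr mul_scal scal_mul hx.
Qed.

Lemma cone_conj_comm h z : star h = h -> h * z = z * h -> cone z ->
  cone (h * z * h).
Proof.
move=> sh hz cz; apply: cone_closed.
  by rewrite !starM sh (cone_sa cz) mulrA.
move=> d d0; set N := nr h ^+ 2 + 1.
have N0 : 0 < N by rewrite ltr_wpDl // sqr_ge0.
have dN : 0 < d / N by rewrite divr_gt0.
have [r [cr rr comr]] := cone_sqrt cz dN.
exists (h * r * (h * r)); split.
  by apply: cone_square; rewrite starM sh (cone_sa cr) comr.
have -> : h * r * (h * r) = h * (r * r) * h.
  by rewrite {2}(comr _ hz) !mulrA.
rewrite rr [X in nr X](_ : _ = - ((d / N)%:C *: (star h * h))); last first.
  by rewrite sh mulrDr mulrDl mul_scal scale_mull; module_ring.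
rewrite nrN nrZ_ge0 ?nr_starM; last exact: ltW.
rewrite mulrAC ler_pdivrMr // ler_pM2l //; rewrite /N; nr_lra.
Qed.

(** With [r ^ 2 = q - a] and [s ^ 2 = q + a], up to small scalars, the commuting
    elements [r] and [s] satisfy [r ^ 2 + s ^ 2 = 2 q], which bounds [|r| ^ 2]. *)
Lemma nr_le_order a q : 0 <= q -> cone (scal q - a) -> cone (scal q + a) ->
  nr a <= 3 * q.
Proof.
move=> q0 cm cp; apply/ler_addgt0Pr => e e0.
have e3 : 0 < e / 3 by lra.
have [r [cr rr comr]] := cone_sqrt cm e3.
have [s [cs ss coms]] := cone_sqrt cp e3.
have ra : r * a = a * r.
  by apply/esym/comr; rewrite mulrBl mulrBr mul_scal scal_mul.
have rs : r * s = s * r.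
  by apply: coms; rewrite mulrDl mulrDr mul_scal scal_mul ra.
have := nr_le_sum_squares (cone_sa cr) (cone_sa cs) rs.
rewrite -nr_starM (cone_sa cr) rr ss.
rewrite [X in _ <= nr X](_ : _ = scal (2 * q + 2 * (e / 3))); last by module_ring.
move=> le_r; have := nr_scalar A (t := 2 * q + 2 * (e / 3)); move=> le_t.
have : nr a <= nr (scal (q + e / 3)) + nr (scal q - a + scal (e / 3)).
  rewrite {1}(_ : a = scal (q + e / 3) - (scal q - a + scal (e / 3))).
    by have := nrD (scal (q + e / 3)) (- (scal q - a + scal (e / 3))); rewrite nrN.
  by module_ring.
have := nr_scalar A (t := q + e / 3); have := le_t; nr_lra.
Qed.

End SquareRoot.

(** * Cones and spectra in a ring with involution *)
Section SpectralCone.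
Variables (R : realType) (S : pzRingType) (st : S -> S) (sc : R -> S).
Variable Q : S -> Prop.
Hypothesis scD : forall s t, sc (s + t) = sc s + sc t.
Hypothesis scM : forall s t, sc (s * t) = sc s * sc t.
Hypothesis sc1 : sc 1 = 1.
Hypothesis scC : forall t x, sc t * x = x * sc t.
Hypothesis stD : forall x y, st (x + y) = st x + st y.
Hypothesis stM : forall x y, st (x * y) = st y * st x.
Hypothesis stsc : forall t, st (sc t) = sc t.
Hypothesis Q_scalar : forall t, 0 <= t -> Q (sc t).
Hypothesis QD : forall x y, Q x -> Q y -> Q (x + y).
Hypothesis Q_arch : forall x, (forall e, 0 < e -> Q (x + sc e)) -> Q x.
Hypothesis Q_unit : forall x, st x = x -> exists t, Q (sc t - x).
(* Conjugation is asked for commuting elements only: the general case is a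
   consequence of Kaplansky's theorem, whose proof uses this section. *)
Hypothesis Q_conj :
  forall h x, st h = h -> h * x = x * h -> Q x -> Q (h * x * h).

(** Let [l0] be the least [l >= 0] with [x + l] in the cone, and suppose that
    [l0 > 0]. Then [z = x + l0] has an inverse [w], and [w <= N] for some [N > 0]. Now
    [(w - N) z (w - N) + (N - w) = N ^ 2 z - N] belongs to the cone, so that
    [z >= 1 / N], against the choice of [l0]. *)
Lemma cone_of_spectrum x : st x = x ->
  (forall c, 0 < c -> invertible (x + sc c)) -> Q x.
Proof.
move=> sx inv_x.
have sc0 : sc 0 = 0 by apply: (addIr (sc 0)); rewrite -scD !add0r.
have scN t : sc (- t) = - sc t.
  by apply: (addIr (sc t)); rewrite -scD !addNr.
have stN y : st (- y) = - st y.
  have st0 : st 0 = 0 by rewrite -sc0 stsc.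
  by apply: (addIr (st y)); rewrite -stD !addNr.
have st1 : st 1 = 1 by rewrite -sc1 stsc.
have unit_pos y : st y = y -> exists2 t, 0 < t & Q (sc t - y).
  move=> /Q_unit [t Qt]; exists (`|t| + 1); first by rewrite ltr_wpDl.
  have -> : sc (`|t| + 1) - y = (sc t - y) + sc (`|t| + 1 - t).
    by rewrite addrAC -scD; congr (sc _ - y); lra.
  by apply: QD => //; apply: Q_scalar; have := ler_norm t; lra.
have up s t : s <= t -> Q (x + sc s) -> Q (x + sc t).
  move=> st' Qs; have -> : x + sc t = x + sc s + sc (t - s).
    by rewrite -addrA -scD; congr (x + sc _); lra.
  by apply: QD => //; apply: Q_scalar; lra.
pose E := [set l | 0 <= l /\ Q (x + sc l)].
have lbE : has_inf E.
  split; last by exists 0 => l [].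
  have [|t t0 Qt] := unit_pos (- x); first by rewrite stN sx.
  by exists t; split; [exact: ltW | rewrite addrC -[x]opprK].
set l0 := inf E.
have l00 : 0 <= l0 by apply: lb_le_inf; [case: lbE | move=> l []].
have Ql0 : Q (x + sc l0).
  apply: Q_arch => e e0; rewrite -addrA -scD.
  have [l [_ Ql] ll0] := inf_adherent e0 lbE.
  by apply: up Ql; exact: ltW.
have [l0E|l0n] := eqVneq l0 0; first by move: Ql0; rewrite l0E sc0 addr0.
have l0p : 0 < l0 by rewrite lt_def l0n.
have [w [zw wz]] := inv_x _ l0p; set z := x + sc l0 in Ql0 zw wz.
have sz : st z = z by rewrite stD sx stsc.
have sw : st w = w.
  have : st w * z = 1 by rewrite -{1}sz -stM zw st1.
  by move/(congr1 (fun y => y * w)); rewrite -mulrA zw mulr1 mul1r.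
have [N N0 QN] := unit_pos _ sw.
have QNz : Q (sc N * z * sc N - sc N).
  have -> : sc N * z * sc N - sc N =
            (w - sc N) * z * (w - sc N) + (sc N - w).
    rewrite mulrBl wz mulrBr !mulrBl !mul1r -[sc N * z * w]mulrA zw mulr1.
    by rewrite opprB [w - sc N + _]addrC -addrA -[sc N - w]opprB subrr addr0.
  apply: QD => //; apply: Q_conj => //; first by rewrite stD stN sw stsc.
  by rewrite mulrBl mulrBr wz zw scC.
have Nn : N != 0 by rewrite gt_eqF.
have QzN : Q (z - sc N^-1).
  have -> : z - sc N^-1 = sc N^-1 * (sc N * z * sc N - sc N) * sc N^-1.
    rewrite mulrBr mulrBl !mulrA -scM mulVf // sc1 !mul1r.
    by rewrite -mulrA -scM divff // sc1 mulr1.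
  by apply: Q_conj; rewrite ?stsc // scC.
have N1 : 0 < N^-1 by rewrite invr_gt0.
pose l1 := Num.max 0 (l0 - N^-1).
have El1 : E l1.
  split; first by rewrite le_max lexx.
  apply: (@up (l0 - N^-1)); first by rewrite le_max lexx orbT.
  by rewrite scD [sc (- N^-1)]scN addrA; exact: QzN.
have : l0 <= l1 by apply: ge_inf => //; case: lbE.
by rewrite /l1 le_max leNgt l0p /=; lra.
Qed.

End SpectralCone.

Section InvertibleRing.
Variable S : pzRingType.
Implicit Types x y u v : S.

Lemma invertible_lr x u v : x * u = 1 -> v * x = 1 -> invertible x.
Proof.
move=> xu vx; exists u; split=> //.
suff -> : u = v by [].
by rewrite -[u]mul1r -vx -mulrA xu mulr1.
Qed.

Lemma invertible_commM x y : x * y = y * x -> invertible (x * y) -> invertible x.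
Proof.
move=> xy [w [xyw wxy]]; apply: (@invertible_lr _ (y * w) (w * y)).
  by rewrite mulrA.
by rewrite -mulrA -xy.
Qed.

End InvertibleRing.

Section SpectrumOfCone.
Variables (R : realType) (S : pzRingType) (sc : R[i] -> S) (st : S -> S).
Variable Q : S -> Prop.
Hypothesis scD : forall s t, sc (s + t) = sc s + sc t.
Hypothesis scM : forall s t, sc (s * t) = sc s * sc t.
Hypothesis sc1 : sc 1 = 1.
Hypothesis scC : forall t x, sc t * x = x * sc t.
Hypothesis stD : forall x y, st (x + y) = st x + st y.
Hypothesis stM : forall x y, st (x * y) = st y * st x.
Hypothesis stsc : forall t : R, st (sc t%:C) = sc t%:C.
Hypothesis Q_sa : forall x, Q x -> st x = x.
Hypothesis Q_scalar : forall t : R, 0 <= t -> Q (sc t%:C).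
Hypothesis QD : forall x y, Q x -> Q y -> Q (x + y).
Hypothesis Q_arch : forall x, (forall e : R, 0 < e -> Q (x + sc e%:C)) -> Q x.
Hypothesis Q_unit : forall x, st x = x -> exists t : R, Q (sc t%:C - x).
Hypothesis Q_conj :
  forall h x, st h = h -> h * x = x * h -> Q x -> Q (h * x * h).
Hypothesis Q_square : forall x, st x = x -> Q (x * x).
Hypothesis Q_invertible :
  forall x (c : R), Q x -> 0 < c -> invertible (x + sc c%:C).

Let scN s : sc (- s) = - sc s.
Proof.
have sc0 : sc 0 = 0 by apply: (addIr (sc 0)); rewrite -scD !add0r.
by apply: (addIr (sc s)); rewrite -scD !addNr.
Qed.

Lemma cone_of_invertible x : st x = x ->
  (forall c : R, 0 < c -> invertible (x + sc c%:C)) -> Q x.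
Proof.
apply: (@cone_of_spectrum R S st (fun t => sc t%:C) Q) => //= *.
- by rewrite -scD -rmorphD.
- by rewrite -scM -rmorphM.
Qed.

(** For the converse of [cone_of_invertible], elements of the cone have no other
    spectral values than the nonnegative reals: if [l = p + 'i q] with [q] nonzero,
    then [x - l] is a factor of [(x - p) ^ 2 + q ^ 2]. *)
Lemma is_positiveP x : is_positive sc st x <-> Q x.
Proof.
split=> [[sx spec_x]|Qx].
  apply: cone_of_invertible => // c c0; apply: contrapT => ninv.
  have : spectrum sc x (- c%:C) by rewrite /spectrum /= scN opprK.
  by move/spec_x => /=; rewrite -rmorphN -[0]/(0%:C) lecR; lra.
have sx := Q_sa Qx; split=> // l /= spec_l; apply: contrapT => nl; apply: spec_l.
case: l nl => p q nl.
have [q0|qn] := eqVneq q 0.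
  have p0 : 0 < - p.
    by rewrite ltNge; apply/negP => np; apply: nl; rewrite lecE /= q0 eqxx; lra.
  have := Q_invertible Qx p0; rewrite -scN; congr (invertible (_ + sc _)).
  by apply/eqP; rewrite eq_complex /= q0 oppr0 !eqxx.
pose y := x - sc p%:C.
have sy : st y = y by rewrite /y -scN -rmorphN stD sx stsc.
have q2 : 0 < q ^+ 2 by rewrite exprn_even_gt0.
have fact (z : S) (k : R[i]) : k ^+ 2 = -1 ->
    (z - sc (k * q%:C)) * (z + sc (k * q%:C)) = z * z + sc (q ^+ 2)%:C.
  move=> k2; rewrite mulrBl !mulrDr -scM scC opprD addrA addrK -scN.
  congr (_ + sc _); rewrite mulrACA -!expr2 k2 mulN1r opprK.
  by rewrite rmorphXn.
have i2 : ('i%R : R[i]) ^+ 2 = -1 by rewrite sqrCi.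
have -> : p +i* q = p%:C + 'i%R * q%:C.
  by rewrite [LHS]complexE /=.
rewrite scD opprD addrA -/y.
apply: (@invertible_commM _ _ (y + sc ('i%R * q%:C))); last first.
  by rewrite fact //; apply: Q_invertible => //; apply: Q_square.
have := fact y (- 'i%R); rewrite sqrrN i2 => /(_ erefl).
by rewrite mulNr scN opprK fact // => ->.
Qed.

End SpectrumOfCone.

(** * Kaplansky's theorem *)
Section Kaplansky.
Variables (R : realType) (A : cstarAlgType R).
Implicit Types (a b x y z u v : A) (s t c d e q : R).
Local Notation scal t := (t%:C *: (1 : A)).

Let sc_mul (s t : R[i]) :
  (s * t) *: (1 : A) = (s *: (1 : A) : A) * (t *: (1 : A) : A).
Proof. by rewrite scale_mull scale_mulr mulr1 scalerA. Qed.

Let sc_comm (s : R[i]) x : (s *: (1 : A) : A) * x = x * (s *: (1 : A) : A).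
Proof. by rewrite scale_mull scale_mulr mulr1 mul1r. Qed.

Let cone_unit x : star x = x -> exists t, cone (scal t - x).
Proof. by move=> sx; exists (nr x); apply: cone_nr_sub. Qed.

Lemma cone_invertibleP a : star a = a ->
  (forall c, 0 < c -> invertible (a + scal c)) -> cone a.
Proof.
apply: (@cone_of_invertible R A (fun l => l *: (1 : A)) (@star R A)).
- by move=> s t; rewrite scalerDl.
- exact: sc_mul.
- by rewrite scale1r.
- exact: sc_comm.
- exact: starD.
- exact: starM.
- exact: star_scalar.
- exact: cone_scalar.
- exact: coneD.
- exact: cone_arch.
- exact: cone_unit.
- exact: cone_conj_comm.
Qed.

Lemma positiveP a : positive a <-> cone a.
Proof.
apply: (@is_positiveP R A (fun l => l *: (1 : A)) (@star R A)).
- by move=> s t; rewrite scalerDl.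
- exact: sc_mul.
- by rewrite scale1r.
- exact: sc_comm.
- exact: starD.
- exact: starM.
- exact: star_scalar.
- exact: cone_sa.
- exact: cone_scalar.
- exact: coneD.
- exact: cone_arch.
- exact: cone_unit.
- exact: cone_conj_comm.
- exact: cone_square.
- exact: cone_invertible.
Qed.

(** If [w] is the inverse of [x y + c], then [(1 - y w x) / c] is that of
    [y x + c]. *)
Lemma invertible_swap x y c : c != 0 ->
  invertible (x * y + scal c) -> invertible (y * x + scal c).
Proof.
move=> c0 [w [xyw wxy]].
have e1 : y * x * (y * w * x) = y * x - c%:C *: (y * w * x).
  have : y * ((x * y + scal c) * w) * x = y * x by rewrite xyw mulr1.
  rewrite mulrDl scal_mul mulrDr scale_mulr mulrDl scale_mull !mulrA => e.
  by rewrite -[in RHS]e; module_ring.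
have e2 : y * w * x * (y * x) = y * x - c%:C *: (y * w * x).
  have : y * (w * (x * y + scal c)) * x = y * x by rewrite wxy mulr1.
  rewrite mulrDr mul_scal mulrDr scale_mulr mulrDl scale_mull !mulrA => e.
  by rewrite -[in RHS]e; module_ring.
exists ((c^-1)%:C *: (1 - y * w * x)); split.
  by rewrite scale_mulr mulrDl mulrBr mulr1 e1 scal_mul; module_field.
by rewrite scale_mull mulrDr mulrBl mul1r e2 mul_scal; module_field.
Qed.

(** With [y = h + 'i k] for self-adjoint [h] and [k], the sum is
    [2 (h ^ 2 + k ^ 2)]. *)
Lemma cone_starM_sum y : cone (star y * y + y * star y).
Proof.
have [i [ii ic]] : exists i : R[i], i * i = -1 /\ (i^*)%R = - i.
  by exists 'i%R; rewrite -expr2 sqrCi conjCi.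
pose h := (2^-1)%:C *: (y + star y).
pose d := (2^-1)%:C *: (star y - y).
have sd : star d = - d by rewrite starZr starD starN starK /d; module_ring.
have sh : star h = h by rewrite starZr starD starK addrC.
have sid : star (i *: d) = i *: d by rewrite starZ ic sd scalerN scaleNr opprK.
have idid : (i *: d) * (i *: d) = - (d * d).
  by rewrite scale_mull scale_mulr scalerA ii scaleN1r.
have -> : star y * y + y * star y =
          2%:C *: (h * h) + 2%:C *: ((i *: d) * (i *: d)).
  rewrite idid /h /d !scale_mull !scale_mulr !(mulrDl, mulrDr, mulNr, mulrN).
  by module_field.
by apply: coneD; apply: coneZ => //; apply: cone_square.
Qed.

Lemma nr_sqr a : star a = a -> nr (a * a) = nr a ^+ 2.
Proof. by move=> sa; rewrite -nr_starM sa. Qed.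

(** An upper bound of [star y * y] is a lower bound of [y * star y] by
    [cone_starM_sum], and [invertible_swap] moves it back to [star y * y]. *)
Lemma cone_starM_of_ge y c : 0 < c ->
  cone (scal c - star y * y) -> cone (star y * y + scal c).
Proof.
move=> c0 cy; apply: cone_invertibleP.
  by rewrite starD starM starK star_scalar.
move=> d d0; rewrite -addrA -scalerDl -rmorphD.
have cd : 0 < c + d by lra.
apply: invertible_swap; first by rewrite gt_eqF.
rewrite rmorphD scalerDl addrA; apply: cone_invertible => //.
have -> : y * star y + scal c =
          (star y * y + y * star y) + (scal c - star y * y) by module_ring.
by apply: coneD => //; apply: cone_starM_sum.
Qed.

(** [g] is [sqrt (a ^ 2 + e ^ 2) - a], an approximation of twice the negative part
    of [a] that is defined with square roots of strictly positive elements only.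
    It is positive since [(g + c) (g' + c)] is invertible for [c > 0], where
    [g' = sqrt (a ^ 2 + e ^ 2) + a] satisfies [g g' = e ^ 2]. *)
Lemma approx_negative_part a e : star a = a -> 0 < e <= 1 ->
  exists g, [/\ cone g, cone (a + g), nr g <= 2 * nr a + 1,
                a * g = g * a &
                g * g = scal (e ^+ 2) - 2%:C *: (a * g)].
Proof.
move=> sa /andP[e0 e1]; have e2 : 0 < e ^+ 2 by rewrite exprn_gt0.
have [m [cm mm comm]] := cone_sqrt (cone_square sa) e2.
have am : a * m = m * a by apply: comm; rewrite mulrA.
have [g gE] : exists g, g = m - a by exists (m - a).
have [g' gE'] : exists g', g' = m + a by exists (m + a).
have gg' : g * g' = scal (e ^+ 2).
  by rewrite gE gE' mulrBl !mulrDr mm am; module_ring.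
have ag : a * g = g * a by rewrite gE mulrBr mulrBl am.
have sg : star g = g by rewrite gE starD starN sa (cone_sa cm).
exists g; split=> //.
- apply: cone_invertibleP => // c c0.
  have ggc : (g + scal c) * (g' + scal c) =
             (2 * c)%:C *: (m + scal ((e ^+ 2 + c ^+ 2) / (2 * c))).
    have cn : c != 0 by rewrite gt_eqF.
    by rewrite mulrDl !mulrDr gg' !mul_scal scal_mul gE gE'; module_field.
  apply: (@invertible_commM _ _ (g' + scal c)).
    rewrite !(mulrDl, mulrDr) !mul_scal !scal_mul gE gE'.
    by rewrite !(mulrDl, mulrDr, mulNr, mulrN) am; module_ring.
  rewrite ggc; apply: invertibleZ; first by rewrite gt_eqF // mulr_gt0.
  apply: cone_invertible => //; rewrite divr_gt0 ?mulr_gt0 //.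
  by rewrite addr_gt0 // exprn_gt0.
- by rewrite (_ : a + g = m) //; rewrite gE; module_ring.
- have nm : nr m <= nr a + 1.
    rewrite -ler_sqr ?nnegrE ?addr_ge0 ?nr_ge0 // -nr_sqr ?(cone_sa cm) // mm.
    apply: le_trans (nrD _ _) _; rewrite nr_sqr //.
    have := nr_scalar A (ltW e2); have := nr_ge0 a.
    have : e ^+ 2 <= 1 by rewrite expr_le1 // ltW.
    move: (nr a) (nr (scal (e ^+ 2))) => p q; nra.
  have := nrD m (- a); rewrite nrN gE; nr_lra.
- have -> : g * g = g * g' - 2%:C *: (g * a).
    by rewrite gE' mulrDr {2}gE mulrBr; module_ring.
  by rewrite gg' ag.
Qed.

(** Let [a = star x * x], and let [g] approximate twice the negative part
    of [a]. For
    [y = x g], the element [star y * y = g a g = (e ^ 2 g - g ^ 3) / 2] is small from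
    above, hence small in norm by [cone_starM_of_ge]. Therefore [a g] is small, so is
    [g ^ 2 = e ^ 2 - 2 a g], and the positive element [a + g] is close to [a]. *)
Lemma cone_starM x : cone (star x * x).
Proof.
set a := star x * x.
have sa : star a = a by rewrite starM starK.
apply: cone_closed => // d d0.
pose G := 2 * nr a + 1; have G1 : 1 <= G by have := nr_ge0 a; rewrite /G; lra.
pose K := 1 + 4 * G * nr x.
have K1 : 1 <= K.
  by have : 0 <= G * nr x by [rewrite mulr_ge0 ?nr_ge0 //; lra]; rewrite /K; lra.
pose e := Num.min 1 (d ^+ 2 / K).
have K0 : 0 < K by lra.
have d2 : 0 < d ^+ 2 by rewrite exprn_gt0.
have e0 : 0 < e by rewrite lt_min ltr01 divr_gt0.
have e1 : e <= 1 by rewrite ge_min lexx.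
have eK : e * K <= d ^+ 2 by rewrite -ler_pdivlMr // ge_min lexx orbT.
have e01 : 0 < e <= 1 by rewrite e0.
have [g [cg cag ng ag gg]] := approx_negative_part sa e01.
exists (a + g); split=> //.
rewrite [X in nr X](_ : _ = - g); last by module_ring.
rewrite nrN -ler_sqr ?nnegrE ?nr_ge0 ?(ltW d0) //; apply: (le_trans _ eK).
have sg := cone_sa cg.
pose y := x * g.
have yy : star y * y = g * a * g by rewrite starM sg /a !mulrA.
have yyE : (e ^+ 2)%:C *: g - 2%:C *: (star y * y) = g * g * g.
  by rewrite gg mulrBl scal_mul scale_mull yy ag.
pose c := e ^+ 2 * G / 2.
have e2 : 0 < e ^+ 2 by rewrite exprn_gt0.
have c0 : 0 < c by rewrite /c divr_gt0 // mulr_gt0 //; lra.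
have cy : cone (scal c - star y * y).
  have -> : scal c - star y * y = (e ^+ 2 / 2)%:C *: (scal G - g) +
      (2^-1)%:C *: ((e ^+ 2)%:C *: g - 2%:C *: (star y * y)).
    by rewrite /c; module_field.
  apply: coneD; apply: coneZ; rewrite ?invr_ge0 //.
  - by rewrite divr_ge0 // ltW.
  - exact: cone_nr_sub.
  - by rewrite yyE; apply: cone_conj_comm.
have cy' := cone_starM_of_ge c0 cy; rewrite addrC in cy'.
have := nr_le_order (ltW c0) cy cy'; rewrite nr_starM => ny2.
have ny : nr y <= 2 * G * e.
  have Ge : 0 <= 2 * G * e by rewrite !mulr_ge0 //; lra.
  rewrite -ler_sqr ?nnegrE ?nr_ge0 //; apply: le_trans ny2 _.
  have -> : (2 * G * e) ^+ 2 = 4 * G * G * e ^+ 2 by ring.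
  have eG : 0 <= e ^+ 2 * G by rewrite mulr_ge0 ?(ltW e2) //; lra.
  have := ler_wpM2l eG G1; move: eG; rewrite /c; move: (e ^+ 2) (G) => p q; lra.
rewrite -nr_sqr // gg.
have e2e : e ^+ 2 <= e by rewrite expr2 ler_piMl // ltW.
have := nrD (scal (e ^+ 2)) (- (2%:C *: (a * g))).
rewrite nrN (@nrZ_ge0 _ _ 2) //; have := nr_scalar A (ltW e2).
have -> : a * g = star x * y by rewrite /y mulrA.
have := nrM (star x) y; rewrite nr_star.
have := ler_wpM2l (nr_ge0 x) ny.
have -> : e * K = e + 2 * (nr x * (2 * G * e)) by rewrite /K; ring.
nr_lra.
Qed.

Lemma cone_conj y z : cone z -> cone (star y * z * y).
Proof.
move=> cz; apply: cone_closed.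
  by rewrite !starM starK (cone_sa cz) mulrA.
move=> d d0; set N := nr y ^+ 2 + 1.
have N0 : 0 < N by rewrite ltr_wpDl // sqr_ge0.
have dN : 0 < d / N by rewrite divr_gt0.
have [r [cr rr _]] := cone_sqrt cz dN.
exists (star (r * y) * (r * y)); split; first exact: cone_starM.
have -> : star (r * y) * (r * y) = star y * (r * r) * y.
  by rewrite starM (cone_sa cr) !mulrA.
rewrite rr [X in nr X](_ : _ = - ((d / N)%:C *: (star y * y))); last first.
  by rewrite mulrDr mulrDl mul_scal scale_mull; module_ring.
rewrite nrN nrZ_ge0 ?nr_starM; last exact: ltW.
rewrite mulrAC ler_pdivrMr // ler_pM2l //; rewrite /N; lra.
Qed.

End Kaplansky.

(** * Positive matrices *)
Section Matrices.
Variables (R : realType) (A : cstarAlgType R).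
Implicit Types (a b x y z : A) (s t c d e q : R).
Local Notation scal t := (t%:C *: (1 : A)).

(** The conjugate transpose of rectangular matrices, so that columns are included;
    it is [mxstar] on square matrices. *)
Definition ctr m n (X : 'M[A]_(m, n)) : 'M[A]_(n, m) :=
  \matrix_(i, j) star (X j i).

Lemma star_sum (I : finType) (F : I -> A) :
  star (\sum_i F i) = \sum_i star (F i).
Proof. by apply: big_morph; [exact: starD | exact: star0]. Qed.

Lemma cone0 : cone (0 : A).
Proof. by rewrite -(scale0r (1 : A)); apply: (@cone_scalar R A 0). Qed.

Lemma cone1 : cone (1 : A).
Proof. by rewrite -(scale1r (1 : A)); apply: (@cone_scalar R A 1). Qed.

Lemma cone_sum (I : finType) (F : I -> A) :
  (forall i, cone (F i)) -> cone (\sum_i F i).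
Proof. by move=> hF; apply: big_ind => //; [exact: cone0 | exact: coneD]. Qed.

Lemma ctrM m n p (X : 'M[A]_(m, n)) (Y : 'M[A]_(n, p)) :
  ctr (X *m Y) = ctr Y *m ctr X.
Proof.
apply/matrixP => i j; rewrite !mxE star_sum; apply: eq_bigr => k _.
by rewrite !mxE starM.
Qed.

Lemma ctrK m n (X : 'M[A]_(m, n)) : ctr (ctr X) = X.
Proof. by apply/matrixP => i j; rewrite !mxE starK. Qed.

Lemma ctrD m n (X Y : 'M[A]_(m, n)) : ctr (X + Y) = ctr X + ctr Y.
Proof. by apply/matrixP => i j; rewrite !mxE starD. Qed.

Lemma ctrN m n (X : 'M[A]_(m, n)) : ctr (- X) = - ctr X.
Proof. by apply/matrixP => i j; rewrite !mxE starN. Qed.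

Lemma ctr0 m n : ctr (0 : 'M[A]_(m, n)) = 0.
Proof. by apply/matrixP => i j; rewrite !mxE star0. Qed.

Lemma ctr_scalar n a : ctr (a%:M : 'M[A]_n) = (star a)%:M.
Proof.
apply/matrixP => i j; rewrite !mxE eq_sym.
by case: (i == j); rewrite /= ?mulr1n ?mulr0n ?star0.
Qed.

Lemma ctr_col_mx m1 m2 n (X : 'M[A]_(m1, n)) (Y : 'M[A]_(m2, n)) :
  ctr (col_mx X Y) = row_mx (ctr X) (ctr Y).
Proof.
apply/matrixP => i j; rewrite !mxE; case: splitP => k _; by rewrite !mxE.
Qed.

Lemma ctr_row_mx m n1 n2 (X : 'M[A]_(m, n1)) (Y : 'M[A]_(m, n2)) :
  ctr (row_mx X Y) = col_mx (ctr X) (ctr Y).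
Proof.
apply/matrixP => i j; rewrite !mxE; case: splitP => k _; by rewrite !mxE.
Qed.

Lemma ctr_block_mx m1 m2 n1 n2 (P : 'M[A]_(m1, n1)) (Q : 'M[A]_(m1, n2))
    (S : 'M[A]_(m2, n1)) (T : 'M[A]_(m2, n2)) :
  ctr (block_mx P Q S T) = block_mx (ctr P) (ctr S) (ctr Q) (ctr T).
Proof.
by rewrite {1}/block_mx ctr_col_mx !ctr_row_mx block_mxEh.
Qed.

Lemma mxstarE n (X : 'M[A]_n) : mxstar X = ctr X.
Proof. by []. Qed.

Definition qform n (X : 'M[A]_n) (v : 'cV[A]_n) : A := (ctr v *m X *m v) 0 0.

Lemma qformE n (X : 'M[A]_n) (v : 'cV_n) :
  qform X v = \sum_i \sum_j star (v i 0) * X i j * v j 0.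
Proof.
rewrite /qform mxE exchange_big /=; apply: eq_bigr => j _.
by rewrite mxE mulr_suml; apply: eq_bigr => i _; rewrite !mxE.
Qed.

Lemma qformD n (X Y : 'M[A]_n) (v : 'cV_n) : qform (X + Y) v = qform X v + qform Y v.
Proof. by rewrite /qform mulmxDr mulmxDl mxE. Qed.

Lemma qformN n (X : 'M[A]_n) (v : 'cV_n) : qform (- X) v = - qform X v.
Proof. by rewrite /qform mulmxN mulNmx mxE. Qed.

Lemma qform_congr n m (X : 'M[A]_n) (Y : 'M[A]_(n, m)) (v : 'cV_m) :
  qform (ctr Y *m X *m Y) v = qform X (Y *m v).
Proof. by rewrite /qform ctrM !mulmxA. Qed.

Lemma star_qform n (X : 'M[A]_n) (v : 'cV_n) : ctr X = X -> star (qform X v) = qform X v.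
Proof.
move=> sX; have : ctr (ctr v *m X *m v) = ctr v *m X *m v.
  by rewrite !ctrM ctrK sX mulmxA.
by move/matrixP/(_ 0 0); rewrite mxE.
Qed.

Lemma qform1E n (v : 'cV[A]_n) : qform 1%:M v = \sum_i star (v i 0) * v i 0.
Proof.
by rewrite /qform mulmx1 mxE; apply: eq_bigr => i _; rewrite mxE.
Qed.

Lemma qform_scalar n (t : R) (v : 'cV[A]_n) :
  qform (scal t)%:M v = t%:C *: qform 1%:M v.
Proof.
rewrite qform1E scaler_sumr qformE; apply: eq_bigr => i _.
rewrite (bigD1 i) //= big1 ?addr0 => [|j ji].
  by rewrite mxE eqxx mulr1n mul_scal scale_mull.
by rewrite mxE eq_sym (negbTE ji) mulr0n mulr0 mul0r.
Qed.

Lemma cone_qform1 n (v : 'cV[A]_n) : cone (qform 1%:M v).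
Proof. by rewrite qform1E; apply: cone_sum => i; apply: cone_starM. Qed.

Definition psd n (X : 'M[A]_n) : Prop :=
  ctr X = X /\ forall v, cone (qform X v).

Lemma invertibleMr (S : pzRingType) (x y : S) :
  invertible x -> invertible y -> invertible (x * y).
Proof.
move=> [u [xu ux]] [w [yw wy]]; exists (w * u); split.
  by rewrite mulrA -[x * y * w]mulrA yw mulr1.
by rewrite mulrA -[w * u * x]mulrA ux mulr1.
Qed.

(** Induction on the size. The upper left entry [a] of [X] satisfies [a >= c], so it
    is invertible. The quadratic form of the Schur complement at [w] is that of [X]
    at [(- a^-1 Q w, w)], so that the Schur complement satisfies the same hypothesis;
    and [X] is invertible together with [a] and with its Schur complement. *)
Lemma coercive_invertible n (X : 'M[A]_n) c : 0 < c -> ctr X = X ->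
  (forall v, cone (qform X v - c%:C *: qform 1%:M v)) -> invertible X.
Proof.
move=> c0; elim: n X => [X _ _|n IH X sX posX].
  by exists 0; split; apply/matrixP => -[].
suff gen : forall (P : 'M[A]_1) (Q : 'M[A]_(1, n)) (S : 'M[A]_(n, 1)) (T : 'M[A]_n),
    ctr (block_mx P Q S T) = block_mx P Q S T ->
    (forall v, cone (qform (block_mx P Q S T) v - c%:C *: qform 1%:M v)) ->
    invertible (block_mx P Q S T : 'M[A]_(1 + n)).
  have := gen (ulsubmx (X : 'M[A]_(1 + n))) (ursubmx (X : 'M[A]_(1 + n)))
              (dlsubmx (X : 'M[A]_(1 + n))) (drsubmx (X : 'M[A]_(1 + n))).
  by rewrite submxK; apply.
move=> {sX posX} P Q S T; rewrite ctr_block_mx => /eq_block_mx [sP sS sQ sT] posX.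
set a := P 0 0.
have PE : P = a%:M by rewrite [LHS]mx11_scalar.
have sa : star a = a by move/matrixP: sP => /(_ 0 0); rewrite mxE.
have cone_a : cone (a - scal c).
  have := posX (col_mx 1%:M 0); congr cone.
  rewrite /qform ctr_col_mx mul_row_block mul_row_col.
  rewrite ctr_scalar star1 ctr0 !mul0mx !mulmx0 !addr0 mul1mx mulmx1 mulmx1.
  rewrite mul_row_col mul0mx addr0 mulmx1 -/a mxE eqxx mulr1n; done.
have [b [ab ba]] : invertible a.
  have := cone_invertible cone_a c0; congr invertible; module_ring.
have sb : star b = b.
  have : star b * a = 1 by rewrite -{1}sa -starM ab star1.
  by move/(congr1 (fun z => z * b)); rewrite -mulrA ab mulr1 mul1r.
pose Z := T - S *m b%:M *m Q.
have Z_inv : invertible Z.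
  apply: IH => [|w].
    by rewrite ctrD ctrN !ctrM ctr_scalar sS sQ sT sb mulmxA.
  pose u := - (b%:M *m Q *m w).
  have := posX (col_mx u w).
  have -> : qform (block_mx P Q S T) (col_mx u w) = qform Z w.
    rewrite /qform -mulmxA mul_block_col ctr_col_mx mul_row_col.
    have -> : P *m u + Q *m w = 0.
      by rewrite PE /u mulmxN !mulmxA -scalar_mxM ab mul1mx addNr.
    rewrite mulmx0 add0r -mulmxA; congr ((_ *m _) _ _).
    by rewrite /Z /u mulmxN mulmxBl !mulmxA addrC.
  have -> : qform 1%:M (col_mx u w) = qform 1%:M u + qform 1%:M w.
    by rewrite /qform !mulmx1 ctr_col_mx mul_row_col mxE.
  move=> h; have -> : qform Z w - c%:C *: qform 1%:M w =
    (qform Z w - c%:C *: (qform 1%:M u + qform 1%:M w)) + c%:C *: qform 1%:M u.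
    by module_ring.
  by apply: coneD => //; apply: coneZ; [exact: ltW | exact: cone_qform1].
have [W [ZW WZ]] := Z_inv.
pose L : 'M[A]_(1 + n) := block_mx 1%:M 0 (S *m b%:M) 1%:M.
pose D : 'M[A]_(1 + n) := block_mx a%:M 0 0 Z.
pose U : 'M[A]_(1 + n) := block_mx 1%:M (b%:M *m Q) 0 1%:M.
have -> : block_mx P Q S T = L * D * U :> 'M[A]_(1 + n).
  rewrite [RHS](_ : _ = L *m D *m U) // mulmx_block.
  rewrite !(mul0mx, mulmx0, mul1mx, mulmx1, add0r, addr0) mulmx_block.
  rewrite !(mul0mx, mulmx0, mul1mx, mulmx1, add0r, addr0).
  rewrite -[S *m b%:M *m a%:M]mulmxA -scalar_mxM ba mulmx1.
  by rewrite !mulmxA -scalar_mxM ab mul1mx PE /Z addrC subrK.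
have one_block : (1 : 'M[A]_(1 + n)) = block_mx 1%:M 0 0 1%:M.
  exact: scalar_mx_block.
apply: invertibleMr; first apply: invertibleMr.
- exists (block_mx 1%:M 0 (- (S *m b%:M)) 1%:M).
  rewrite one_block; split; rewrite [LHS]mulmx_block.
  + by rewrite !(mul0mx, mulmx0, mul1mx, mulmx1, add0r, addr0) addrN.
  + by rewrite !(mul0mx, mulmx0, mul1mx, mulmx1, add0r, addr0) addNr.
- exists (block_mx b%:M 0 0 W).
  rewrite one_block; split; rewrite [LHS]mulmx_block.
  + by rewrite !(mul0mx, mulmx0, add0r, addr0) -scalar_mxM ab [Z *m W]ZW.
  + by rewrite !(mul0mx, mulmx0, add0r, addr0) -scalar_mxM ba [W *m Z]WZ.
- exists (block_mx 1%:M (- (b%:M *m Q)) 0 1%:M).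
  rewrite one_block; split; rewrite [LHS]mulmx_block.
  + by rewrite !(mul0mx, mulmx0, mul1mx, mulmx1, add0r, addr0) addNr.
  + by rewrite !(mul0mx, mulmx0, mul1mx, mulmx1, add0r, addr0) addrN.
Qed.

End Matrices.

Section MatrixPositivity.
Variables (R : realType) (A : cstarAlgType R).
Implicit Types (a b x y z : A) (s t c d e q : R).
Local Notation scal t := (t%:C *: (1 : A)).

Lemma cone_arch_dir x y : star x = x ->
  (forall e, 0 < e -> cone (x + e%:C *: y)) -> cone x.
Proof.
move=> sx hx; apply: cone_closed => // d d0.
have N0 : 0 < nr y + 1 by have := nr_ge0 y; lra.
have e0 : 0 < d / (nr y + 1) by rewrite divr_gt0.
exists (x + (d / (nr y + 1))%:C *: y); split; first exact: hx.
rewrite opprD addrA subrr add0r nrN nrZ_ge0; last exact: ltW.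
by rewrite mulrAC ler_pdivrMr // ler_pM2l //; lra.
Qed.

Lemma psdD n (X Y : 'M[A]_n) : psd X -> psd Y -> psd (X + Y).
Proof.
move=> [sX pX] [sY pY]; split; first by rewrite ctrD sX sY.
by move=> v; rewrite qformD; apply: coneD.
Qed.

Lemma psd_scalar n t : 0 <= t -> psd ((scal t)%:M : 'M[A]_n).
Proof.
move=> t0; split; first by rewrite ctr_scalar star_scalar.
by move=> v; rewrite qform_scalar; apply: coneZ => //; apply: cone_qform1.
Qed.

Lemma psd_congr n m (X : 'M[A]_n) (Y : 'M[A]_(n, m)) :
  psd X -> psd (ctr Y *m X *m Y).
Proof.
move=> [sX pX]; split; first by rewrite !ctrM ctrK sX mulmxA.
by move=> v; rewrite qform_congr.
Qed.

Lemma scale_sum (I : finType) (c : R[i]) (F : I -> A) :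
  c *: (\sum_i F i) = \sum_i c *: F i.
Proof. by apply: big_morph; [exact: scalerDr | exact: scaler0]. Qed.

Lemma sum_opp (I : finType) (F : I -> A) : \sum_i - F i = - \sum_i F i.
Proof. by apply/esym/big_morph; [exact: opprD | exact: oppr0]. Qed.

Lemma sum_constant n x : \sum_(i < n) x = n%:R%:C *: x.
Proof.
elim: n => [|n IH]; first by rewrite big_ord0 scale0r.
by rewrite big_ord_recr /= IH -natr1; module_ring.
Qed.

(** Twice the quadratic form is the sum over [i] and [j] of
    [star v_i X_ij v_j + star v_j X_ji v_i], and each such term is at most
    [star v_i v_i + K star v_j v_j] because [star p * p >= 0] for
    [p = v_i - X_ij v_j]. *)
Lemma psd_order_unit n (X : 'M[A]_n) : ctr X = X ->
  exists t, psd ((scal t)%:M - X).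
Proof.
move=> sX; pose K := \sum_i \sum_j nr (X i j) ^+ 2.
have XK i j : nr (X i j) ^+ 2 <= K.
  rewrite /K (bigD1 i) //= (bigD1 j) //= -addrA ler_wpDr // addr_ge0 //.
    by apply: sumr_ge0 => k _; apply: sqr_ge0.
  by apply: sumr_ge0 => k _; apply: sumr_ge0 => l _; apply: sqr_ge0.
exists (2^-1 * (n%:R * (1 + K))); split.
  by rewrite ctrD ctrN ctr_scalar star_scalar sX.
move=> v; rewrite qformD qformN qform_scalar qform1E qformE.
pose T i j := star (v i 0) * v i 0 + K%:C *: (star (v j 0) * v j 0)
  - star (v i 0) * X i j * v j 0 - star (v j 0) * X j i * v i 0.
rewrite [X in cone X](_ : _ = (2^-1)%:C *: \sum_i \sum_j T i j).
  apply: coneZ => //; apply: cone_sum => i; apply: cone_sum => j.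
  have Xji : star (X i j) = X j i by rewrite -{2}sX mxE.
  pose p := v i 0 - X i j * v j 0.
  rewrite [X in cone X](_ : _ = star p * p +
     star (v j 0) * (scal K - star (X i j) * X i j) * v j 0).
    apply: coneD; first exact: cone_starM.
    apply: cone_conj; apply: cone_nr_sub; first by rewrite starM starK.
    by rewrite nr_starM.
  rewrite /T /p starD starN starM Xji !(mulrDl, mulrDr, mulNr, mulrN) !mulrA.
  by rewrite mul_scal scale_mull; module_ring.
have sumB (F G : 'I_n -> 'I_n -> A) :
    \sum_i \sum_j (F i j - G i j) = \sum_i \sum_j F i j - \sum_i \sum_j G i j.
  rewrite -sum_opp -big_split /=; apply: eq_bigr => i _.
  by rewrite -sum_opp -big_split.
pose V := \sum_i star (v i 0) * v i 0.
have sumV : \sum_i \sum_(j < n) star (v i 0) * v i 0 = n%:R%:C *: V.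
  by rewrite scale_sum; apply: eq_bigr => i _; rewrite sum_constant.
have sumV' : \sum_(i < n) \sum_j K%:C *: (star (v j 0) * v j 0) =
             n%:R%:C *: (K%:C *: V).
  by rewrite sum_constant -scale_sum.
have sumD (F G : 'I_n -> 'I_n -> A) :
    \sum_i \sum_j (F i j + G i j) = \sum_i \sum_j F i j + \sum_i \sum_j G i j.
  by rewrite -big_split /=; apply: eq_bigr => i _; rewrite -big_split.
rewrite /T !sumB sumD sumV sumV'.
rewrite [\sum_i \sum_j star (v j 0) * X j i * v i 0]exchange_big /=.
by module_field.
Qed.

(** The ring of entries is not commutative, but complex scalars are central in
    it. *)
Lemma mul_mx_scalarC n a (X : 'M[A]_n) : (forall x, a * x = x * a) ->
  a%:M *m X = X *m a%:M.
Proof.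
move=> ca; rewrite mul_scalar_mx; apply/matrixP => i j; rewrite !mxE.
rewrite (bigD1 j) //= big1 => [|k kj]; rewrite mxE.
  by rewrite eqxx mulr1n addr0 ca.
by rewrite (negbTE kj) mulr0n mulr0.
Qed.

Lemma mxpositiveP n (X : 'M[A]_n) : mxpositive X <-> psd X.
Proof.
apply: (@is_positiveP R _ (fun l => (l *: (1 : A))%:M) (@mxstar R A n)).
- by move=> s t; rewrite scalerDl raddfD.
- by move=> s t; rewrite -[RHS]/(_ *m _) -scalar_mxM scale_mull mul1r scalerA.
- by rewrite scale1r.
- move=> t Y; apply: mul_mx_scalarC => x.
  by rewrite scale_mull scale_mulr mul1r mulr1.
- exact: ctrD.
- exact: ctrM.
- by move=> t; rewrite mxstarE ctr_scalar star_scalar.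
- by move=> Y [].
- exact: psd_scalar.
- exact: psdD.
- move=> Y hY; have sY : ctr Y = Y.
    have [] := hY 1 ltr01; rewrite ctrD ctr_scalar star_scalar.
    by move/addIr.
  split=> // v; apply: (@cone_arch_dir _ (qform 1%:M v)); first exact: star_qform.
  by move=> e /hY [_ /(_ v)]; rewrite qformD qform_scalar.
- exact: psd_order_unit.
- move=> h Y sh _ pY; have := psd_congr h pY.
  by rewrite -mxstarE sh.
- move=> Y sY; have := psd_congr Y (psd_scalar n ler01).
  by rewrite scale1r mulmx1 -mxstarE sY.
- move=> Y c [sY pY] c0; apply: (coercive_invertible c0).
    by rewrite ctrD ctr_scalar star_scalar sY.
  by move=> v; rewrite qformD qform_scalar addrK.
Qed.

Lemma psd_rank1 n (X : 'M[A]_n) h (g : 'I_n -> A) : cone h ->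
  (forall i j, X i j = star (g i) * h * g j) -> psd X.
Proof.
move=> ch XE; pose G : 'rV[A]_n := \row_i g i.
have -> : X = ctr G *m h%:M *m G.
  apply/matrixP => i j; rewrite XE mxE big_ord1 mxE big_ord1 !mxE.
  by rewrite eqxx mulr1n.
apply: psd_congr; split; first by rewrite ctr_scalar (cone_sa ch).
move=> v; rewrite qformE !big_ord1 mxE eqxx mulr1n; exact: cone_conj.
Qed.

Lemma psd_qform3 (F : nat -> nat -> A) x0 x1 x2 :
  psd (\matrix_(i < 3, j < 3) F i j) ->
  cone (star x0 * F 0%N 0%N * x0 + star x0 * F 0%N 1%N * x1 + star x0 * F 0%N 2%N * x2
      + star x1 * F 1%N 0%N * x0 + star x1 * F 1%N 1%N * x1 + star x1 * F 1%N 2%N * x2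
      + star x2 * F 2%N 0%N * x0 + star x2 * F 2%N 1%N * x1 + star x2 * F 2%N 2%N * x2).
Proof.
move=> [_ /(_ (\col_i nth 0 [:: x0; x1; x2] i))].
rewrite qformE !big_ord_recl !big_ord0 !mxE /= !addr0 !addrA.
done.
Qed.

End MatrixPositivity.

(** * Convex sequences in the order of a C*-algebra *)
Section OrderedSpace.
Variables (R : realType) (B : cstarAlgType R).
Implicit Types (a b x y z : B) (s t c d e : R).

Lemma cone_antisym x : cone x -> cone (- x) -> x = 0.
Proof.
move=> cx cnx; apply: (@nr_eq0_small _ _ _ 3) => // e e0.
apply: nr_le_order; first exact: ltW.
  by apply: coneD => //; apply: cone_scalar; exact: ltW.
by apply: coneD => //; apply: cone_scalar; exact: ltW.
Qed.

(** By convexity [u n - u 0 >= n (u 1 - u 0)], hence [n (u 0 - u 1) >= u 0 - b] for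
    all [n]; divide by [n]. *)
Lemma cone_convex_bounded (u : nat -> B) b :
  (forall n, cone (u n + u n.+2 - 2%:C *: u n.+1)) ->
  (forall n, cone (b - u n)) -> cone (u 0%N - u 1%N).
Proof.
move=> conv bound.
have incr n : cone (u n.+1 - u n - (u 1%N - u 0%N)).
  elim: n => [|n IH]; first by rewrite subrr; apply: cone0.
  have := coneD IH (conv n); congr cone; module_ring.
have above n : cone (n%:R%:C *: (u 0%N - u 1%N) + (b - u 0%N)).
  have : cone (u n - u 0%N - n%:R%:C *: (u 1%N - u 0%N)).
    elim: n => [|n IH]; first by rewrite subrr scale0r subr0; apply: cone0.
    by have := coneD IH (incr n); congr cone; rewrite -natr1; module_ring.
  by move=> h; have := coneD h (bound n); congr cone; module_ring.
apply: (@cone_arch_dir _ _ _ (b - u 0%N)).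
  have sb := cone_sa (bound 0%N); have := cone_sa (above 1%N).
  by rewrite scale1r starD sb => /addIr.
move=> e e0; have [n ne] : exists n : nat, e^-1 < n.+1%:R.
  by exists (Num.trunc e^-1); apply: (truncnS_gt).
have n0 : 0 < n.+1%:R :> R by rewrite ltr0n.
have nn : n.+1%:R != 0 :> R by rewrite gt_eqF.
have -> : u 0%N - u 1%N + e%:C *: (b - u 0%N) =
   (n.+1%:R^-1)%:C *: (n.+1%:R%:C *: (u 0%N - u 1%N) + (b - u 0%N)) +
   (e - n.+1%:R^-1)%:C *: (b - u 0%N).
  by move: (n.+1%:R : R) nn => m mn; module_field.
apply: coneD; apply: coneZ.
- by rewrite invr_ge0 ltW.
- exact: above.
- by rewrite subr_ge0 -[e]invrK lef_pV2 ?posrE ?invr_gt0 // ltW.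
- exact: bound.
Qed.

End OrderedSpace.

(** * Convexity of slopes, and fixed scalars *)
Section NonlinearMap.
Variables (R : realType) (A B : cstarAlgType R) (Phi : A -> B).
Implicit Types (a b : A) (p q r s t c d e : R).
Local Notation scal C t := (t%:C *: (1 : C)).

Hypothesis Phi_unital : Phi 1 = 1.
Hypothesis Phi_3positive : n_positive 3 Phi.
Hypothesis Phi_Smonp2 : Smonp 2 Phi.
Hypothesis Phi0 : Phi 0 = 0.

Lemma Phi_positive a : cone a -> cone (Phi a).
Proof. by move=> /positiveP pa; apply/positiveP; case: Phi_Smonp2 => + _; apply. Qed.

(** All positive matrices used below are sums of at most two terms of the form
    [star g_i * h * g_j] with [h] positive. *)
Lemma Phi_psd (X : nat -> nat -> A) (h h' : A) (g g' : nat -> A) :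
  cone h -> cone h' ->
  (forall i j, X i j = star (g i) * h * g j + star (g' i) * h' * g' j) ->
  psd (\matrix_(i < 3, j < 3) Phi (X i j)).
Proof.
move=> ch ch' XE.
rewrite (_ : \matrix_(i, j) _ = map_mx Phi (\matrix_(i < 3, j < 3) X i j)); last first.
  by apply/matrixP => i j; rewrite !mxE.
apply/mxpositiveP; apply: Phi_3positive; apply/mxpositiveP.
rewrite (_ : \matrix_(i, j) _ = \matrix_(i, j) (star (g i) * h * g j) +
    \matrix_(i, j) (star (g' i) * h' * g' j)); last first.
  by apply/matrixP => i j; rewrite !mxE XE.
apply: psdD.
  by apply: (@psd_rank1 _ _ _ _ h (fun i => g i)) => // i j; rewrite mxE.
by apply: (@psd_rank1 _ _ _ _ h' (fun i => g' i)) => // i j; rewrite mxE.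
Qed.

Lemma Phi_gram (g : nat -> A) :
  psd (\matrix_(i < 3, j < 3) Phi (star (g i) * g j)).
Proof.
have := @Phi_psd (fun i j => star (g i) * g j) 1 0 g (fun=> 0) (cone1 A) (cone0 A).
by apply=> i j; rewrite mulr1 !mulr0 addr0.
Qed.

Lemma Phi_star a : star (Phi a) = Phi (star a).
Proof.
have [] := Phi_gram (nth 0 [:: 1; a; 0]).
move=> /matrixP /(_ (inord 1) (inord 0)); rewrite !mxE !inordK //=.
by rewrite star1 mul1r mulr1.
Qed.

(** The entrywise image of [[a + b, b], [b, b]] dominates that of [[a, 0], [0, 0]],
    the difference of these matrices having all its entries equal to [b]. Evaluate
    the quadratic form of the difference of the images at [(1, - 1)]. *)
Lemma Phi_superadditive a b : cone a -> cone b ->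
  cone (Phi (a + b) - Phi a - Phi b).
Proof.
move=> ca cb.
pose X : 'M[A]_2 := \matrix_(i, j) (if (i == 0) && (j == 0) then a + b else b).
pose Y : 'M[A]_2 := \matrix_(i, j) (if (i == 0) && (j == 0) then a else 0).
have pXY : mxpositive (X - Y).
  apply/mxpositiveP/(@psd_rank1 _ _ _ _ b (fun=> 1)) => // i j.
  rewrite !mxE star1 mul1r mulr1; case: ifP => _; last by rewrite subr0.
  by rewrite addrC addKr.
have pY : mxpositive Y.
  apply/mxpositiveP/(@psd_rank1 _ _ _ _ a (fun i => if i == 0 then 1 else 0)) => //.
  move=> i j; rewrite !mxE; case: (i == 0) => /=.
    by case: (j == 0); rewrite ?star1 ?mul1r ?mulr1 ?mulr0.
  by rewrite star0 !mul0r.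
have /mxpositiveP [_ /(_ (\col_i (if i == 0 then 1 else - 1)))] :=
  Phi_Smonp2.2 _ _ pXY pY.
rewrite qformE !big_ord_recl !big_ord0 !mxE /= !addr0 starN star1 Phi0.
by rewrite !(mulNr, mulrN, mul1r, mulr1); congr cone; module_ring.
Qed.

(** The quadratic form of the image of [a + v_i v_j b], with [v = (0, p, q)], at
    [(- s - t, s, t)]: since these coordinates add up to zero, [Phi a] is
    subtracted from each value. *)
Lemma Phi_log_convex a b p q s t : cone a -> cone b ->
  cone ((s ^+ 2)%:C *: (Phi (a + (p ^+ 2)%:C *: b) - Phi a)
      + (2 * s * t)%:C *: (Phi (a + (p * q)%:C *: b) - Phi a)
      + (t ^+ 2)%:C *: (Phi (a + (q ^+ 2)%:C *: b) - Phi a)).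
Proof.
move=> ca cb; pose v : nat -> R := nth 0 [:: 0; p; q].
have := @Phi_psd (fun i j => a + (v i * v j)%:C *: b) a b (fun=> 1)
  (fun i => scal A (v i)) ca cb.
have hX (i j : nat) : a + (v i * v j)%:C *: b =
    star 1 * a * 1 + star (scal A (v i)) * b * scal A (v j).
  by rewrite star1 mul1r mulr1 star_scalar mul_scal scal_mul scalerA mulrC rmorphM.
move=> /(_ hX) /(@psd_qform3 R B (fun i j => Phi (a + (v i * v j)%:C *: b))).
move=> /(_ (scal B (- s - t)) (scal B s) (scal B t)).
rewrite !star_scalar !mul_scal !scal_mul /v /= !(mul0r, mulr0) !scale0r !addr0.
rewrite -!expr2 [q * p]mulrC; congr cone; module_ring.
Qed.

Definition slope a b t : B := (t^-1)%:C *: (Phi (a + t%:C *: b) - Phi a).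

Lemma slope_log_convex a b p q : cone a -> cone b -> 0 < p -> 0 < q ->
  cone (slope a b (p ^+ 2) + slope a b (q ^+ 2) - 2%:C *: slope a b (p * q)).
Proof.
move=> ca cb p0 q0; have := Phi_log_convex p q p^-1 (- q^-1) ca cb.
have pn : p != 0 by rewrite gt_eqF.
have qn : q != 0 by rewrite gt_eqF.
by congr cone; rewrite /slope; module_field.
Qed.

(** Along a geometric progression of [t], a convex function of [log t] is a convex
    sequence. *)
Lemma slope_geometric_decreasing a b (m : B) s t : cone a -> cone b -> 0 < s -> 0 < t ->
  (forall n, cone (m - slope a b (t * s ^+ n))) ->
  cone (slope a b t - slope a b (t * s)).
Proof.
move=> ca cb s0 t0 bound.
have := @cone_convex_bounded R B (fun n => slope a b (t * s ^+ n)) m.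
rewrite expr0 expr1 mulr1; apply=> // n.
have [ts ss] : 0 < Num.sqrt t /\ 0 < Num.sqrt s by rewrite !sqrtr_gt0.
have := @slope_log_convex a b (Num.sqrt t * Num.sqrt s ^+ n)
  (Num.sqrt t * Num.sqrt s ^+ n.+2) ca cb.
have tE : Num.sqrt t * Num.sqrt t = t by rewrite -expr2 sqr_sqrtr // ltW.
have sE : Num.sqrt s ^+ 2 = s by rewrite sqr_sqrtr // ltW.
have -> : (Num.sqrt t * Num.sqrt s ^+ n) ^+ 2 = t * s ^+ n.
  by rewrite expr2 mulrACA tE -expr2 -exprM mulnC exprM sE.
have -> : (Num.sqrt t * Num.sqrt s ^+ n.+2) ^+ 2 = t * s ^+ n.+2.
  by rewrite expr2 mulrACA tE -expr2 -exprM mulnC exprM sE.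
have -> : Num.sqrt t * Num.sqrt s ^+ n * (Num.sqrt t * Num.sqrt s ^+ n.+2) =
          t * s ^+ n.+1.
  rewrite mulrACA tE -exprD; congr (_ * _).
  by rewrite -[in RHS]sE -exprM; congr (_ ^+ _); rewrite mul2n -addnn addSnnS.
by apply; rewrite mulr_gt0 // exprn_gt0.
Qed.

(** Let [g = (1, c^*, a)] and [D = Phi (c a) - c Phi a]. On the first two coordinates
    the quadratic form of the image of [star g_i * g_j] vanishes at [(c^*, - 1)], so at
    [(c^* D, - D, t)] it equals [- 2 t star D * D + t ^ 2 Phi (star a * a)]. Divide
    by [2 t] and let [t] tend to [0]. *)
Lemma Phi_scale_of_fixed (c : R[i]) :
  Phi (c *: (1 : A)) = c *: (1 : B) ->
  Phi ((`|c| ^+ 2) *: (1 : A)) = (`|c| ^+ 2) *: (1 : B) ->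
  forall a, Phi (c *: a) = c *: Phi a.
Proof.
move=> fc fc2 a; have [k kE] : exists k : R[i], k = (c^*)%R by exists (c^*)%R.
have kk : (k^*)%R = c by rewrite kE conjCK.
have kc : `|c| ^+ 2 = c * k by rewrite normCK kE.
rewrite kc in fc2.
have [w wE] : exists w, w = k *: (1 : A) by exists (k *: (1 : A)).
have sw : star w = c *: (1 : A) by rewrite wE starZ star1 kk.
have fw : Phi w = k *: (1 : B).
  by rewrite -[w]starK sw -Phi_star fc starZ star1 -kE.
have fww : Phi (star w * w) = (c * k) *: (1 : B).
  by rewrite sw wE scale_mull scale_mulr mulr1 scalerA.
have [D DE] : exists D, D = Phi (c *: a) - c *: Phi a.
  by exists (Phi (c *: a) - c *: Phi a).
have sD : star D = star (Phi (c *: a)) - k *: star (Phi a).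
  by rewrite DE starD starN starZ -kE.
have DD : 2%:C *: (star D * D) = star D * Phi (c *: a) - c *: (star D * Phi a)
   + (star (Phi (c *: a)) * D - k *: (star (Phi a) * D)).
  have e1 : star D * D = star D * Phi (c *: a) - c *: (star D * Phi a).
    by rewrite {2}DE mulrDr mulrN scale_mulr.
  have e2 : star D * D = star (Phi (c *: a)) * D - k *: (star (Phi a) * D).
    by rewrite sD mulrDl mulNr scale_mull.
  by rewrite -e1 -e2; module_ring.
have small t : 0 < t ->
    cone (- (star D * D) + t%:C *: ((2^-1)%:C *: Phi (star a * a))).
  move=> t0; have := Phi_gram (nth 0 [:: 1; w; a]).
  move=> /(@psd_qform3 R B (fun i j => Phi (star (nth 0 [:: 1; w; a] i) *
     nth 0 [:: 1; w; a] j))).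
  move=> /(_ (k *: D) (- D) (scal B t)) /=.
  have -> : Phi (star w * a) = Phi (c *: a) by rewrite sw scale_mull mul1r.
  have -> : Phi (star a * w) = star (Phi (c *: a)).
    by rewrite Phi_star starZ wE scale_mulr mulr1 -kE.
  rewrite star1 !mul1r !mulr1 fww sw fw fc Phi_unital -Phi_star.
  rewrite starN starZ star_scalar kk.
  rewrite !(mulNr, mulrN, mulr1, mul1r, scale_mull, scale_mulr).
  have t2 : 0 <= (2 * t)^-1 by rewrite invr_ge0 mulr_ge0 // ltW.
  have tn : t != 0 by rewrite gt_eqF.
  move=> h; have := coneZ t2 h; congr cone.
  have -> : - (star D * D) = - ((2^-1)%:C *: (2%:C *: (star D * D))).
    by module_field.
  by rewrite DD; module_field.
have D0 : cone (- (star D * D)).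
  apply: (cone_arch_dir _ small); by rewrite starN starM starK.
have : nr D ^+ 2 = 0.
  by rewrite -nr_starM (cone_antisym (cone_starM D) D0) nr0.
by move/eqP; rewrite sqrf_eq0 => /eqP/nr0_eq0; rewrite DE => /subr0_eq.
Qed.


Lemma slope01 t : slope 0 1 t = (t^-1)%:C *: Phi (scal A t).
Proof. by rewrite /slope add0r Phi0 subr0. Qed.

Lemma Phi_fixed_of_slope t : 0 < t -> slope 0 1 t = 1 ->
  Phi (scal A t) = scal B t.
Proof.
move=> t0; rewrite slope01 => h.
have tn : t != 0 by rewrite gt_eqF.
by rewrite -h; module_field.
Qed.

Lemma slope_of_Phi_fixed t : 0 < t -> Phi (scal A t) = scal B t ->
  slope 0 1 t = 1.
Proof.
move=> t0 h; rewrite slope01 h; have tn : t != 0 by rewrite gt_eqF.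
by module_field.
Qed.

Lemma slope1 : slope 0 1 1 = 1.
Proof. by apply: slope_of_Phi_fixed; rewrite ?ltr01 // !scale1r. Qed.

Lemma Phi_nat_mul n a : cone a -> cone (Phi (n%:R%:C *: a) - n%:R%:C *: Phi a).
Proof.
move=> ca; elim: n => [|n IH].
  by rewrite !scale0r Phi0 subr0; apply: cone0.
have cna : cone (n%:R%:C *: a) by apply: coneZ.
have := coneD IH (Phi_superadditive cna ca).
have -> : n.+1%:R%:C *: a = n%:R%:C *: a + a by rewrite -natr1; module_ring.
by congr cone; rewrite -natr1; module_ring.
Qed.

(** If [n] is the integral part of [1 / t], then [n Phi (t 1) <= Phi 1] by
    superadditivity, and [n t >= 1 / 2]. *)
Lemma slope_le2 t : 0 < t <= 1 -> cone (scal B 2 - slope 0 1 t).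
Proof.
move=> /andP[t0 t1]; pose n := Num.trunc t^-1.
have tn : t != 0 by rewrite gt_eqF.
have /andP[nt nt'] : n%:R <= t^-1 < n.+1%:R by apply: truncn_itv; rewrite invr_ge0 ltW.
have n1 : (1 <= n)%N.
  by rewrite -ltnS -(ltr_nat R); apply: le_lt_trans nt'; rewrite invf_ge1.
have n1R : 1 <= n%:R :> R by rewrite ler1n.
have ntle : n%:R * t <= 1 by rewrite -ler_pdivlMr // mul1r.
have ntgt : 1 < n.+1%:R * t by rewrite -ltr_pdivrMr // mul1r.
have ntge : 1 <= 2 * (n%:R * t).
  have : t <= n%:R * t by rewrite ler_peMl // ltW.
  by move: ntgt; rewrite -natr1 mulrDl mul1r; lra.
have nt0 : 0 < n%:R * t by lra.
have nn : n%:R != 0 :> R by rewrite gt_eqF //; lra.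
have ct : cone (scal A t) by apply: cone_scalar; exact: ltW.
have ctn : cone (n%:R%:C *: scal A t) by apply: coneZ.
have c1 : cone (scal A (1 - n%:R * t)) by apply: cone_scalar; lra.
have s1 := Phi_superadditive ctn c1.
have s2 := coneD (coneD (Phi_positive c1) s1) (Phi_nat_mul n ct).
move: s2; have -> : n%:R%:C *: scal A t + scal A (1 - n%:R * t) = 1 by module_ring.
rewrite Phi_unital => s2.
have nti : 0 <= (n%:R * t)^-1 by rewrite invr_ge0 ltW.
have s3 := coneZ nti s2.
have d0 : 0 <= 2 - (n%:R * t)^-1.
  by rewrite subr_ge0 -[_^-1]mul1r ler_pdivrMr.
have := coneD s3 (cone_scalar B d0); congr cone; rewrite slope01.
by move: (n%:R : R) nn => m mn; module_field.
Qed.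

(** Slopes on [(0, 1]] are bounded, so they decrease along [1, r, r ^ 2] from the
    value [1] at [t = 1]. This gives the value at [r], and then convexity bounds the
    value at [r ^ 2] from below. *)
Lemma slope_fixed_small r : 0 < r < 1 -> cone (slope 0 1 r - 1) ->
  slope 0 1 r = 1 /\ slope 0 1 (r ^+ 2) = 1.
Proof.
move=> /andP[r0 r1] hr.
have bound t n : 0 < t <= 1 -> cone (scal B 2 - slope 0 1 (t * r ^+ n)).
  move=> /andP[t0 t1]; apply: slope_le2; rewrite mulr_gt0 ?exprn_gt0 //=.
  apply: mulr_ile1 => //; first exact: ltW.
    by rewrite exprn_ge0 // ltW.
  by rewrite exprn_ile1 // ltW.
have dec t : 0 < t <= 1 -> cone (slope 0 1 t - slope 0 1 (t * r)).
  move=> /[dup] t01 /andP[t0 _].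
  apply: (slope_geometric_decreasing (m := scal B 2)) => //; first exact: cone0.
    exact: cone1.
  by move=> n; apply: bound.
have h1 : slope 0 1 r = 1.
  apply/eqP; rewrite -subr_eq0; apply/eqP; apply: cone_antisym => //.
  by have := dec 1; rewrite mul1r slope1 opprB lexx ltr01; apply.
split=> //; apply/eqP; rewrite -subr_eq0; apply/eqP; apply: cone_antisym.
  have := slope_log_convex (cone0 A) (cone1 A) ltr01 r0.
  by rewrite expr1n slope1 mul1r h1; congr cone; module_ring.
by rewrite opprB -{1}h1 expr2; apply: dec; rewrite r0 ltW.
Qed.

Lemma slope_sqrt_convex s : 0 < s ->
  cone (slope 0 1 s + slope 0 1 s^-1 - 2%:C *: (1 : B)).
Proof.
move=> s0; have q0 : 0 < Num.sqrt s by rewrite sqrtr_gt0.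
have q1 : 0 < (Num.sqrt s)^-1 by rewrite invr_gt0.
have := slope_log_convex (cone0 A) (cone1 A) q0 q1.
by rewrite exprVn sqr_sqrtr ?ltW // divff ?gt_eqF // slope1.
Qed.

Definition fixes t := Phi (scal A t) = scal B t.

(** The matrix [[r, alpha], [alpha^*, r]] is positive. With [f = Phi (r 1)], the
    quadratic form of its image [[f, alpha], [alpha^*, f]] at [(1, - alpha^* / r)] is
    [2 f - 2 r], so the slope at [r] is at least [1]. *)
Lemma fixes_norm (alpha : R[i]) r : `|alpha| = r%:C -> 0 < r < 1 ->
  Phi (alpha *: (1 : A)) = alpha *: (1 : B) -> fixes r /\ fixes (r ^+ 2).
Proof.
move=> ar /[dup] r01 /andP[r0 r1] fa.
have rn : r != 0 by rewrite gt_eqF.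
suff /(slope_fixed_small r01) [h1 h2] : cone (slope 0 1 r - 1).
  by split; apply: Phi_fixed_of_slope => //; rewrite exprn_gt0.
have [k kE] : exists k : R[i], k = (alpha^*)%R by exists (alpha^*)%R.
have kk : (k^*)%R = alpha by rewrite kE conjCK.
have ak : alpha * k = r%:C * r%:C by rewrite kE -normCK ar expr2.
have fk : Phi (k *: (1 : A)) = k *: (1 : B).
  by have := Phi_star (alpha *: (1 : A)); rewrite fa !starZ !star1 -kE => <-.
have rC : r%:C != 0 :> R[i] by rewrite fmorph_eq0.
have [w wE] : exists w, w = (alpha / r%:C) *: (1 : A).
  by exists ((alpha / r%:C) *: (1 : A)).
have sw : star w = (k / r%:C) *: (1 : A).
  rewrite wE starZ star1 kE; congr (_ *: _); rewrite rmorphM; congr (_ * _).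
  by rewrite fmorphV /= conj_Creal // complex_real.
pose g := nth 0 [:: 1; w; 0].
have hg i j : star (g i) * scal A r * g j =
    star (g i) * scal A r * g j + star 0 * 0 * 0 by rewrite mulr0 addr0.
have := Phi_psd (cone_scalar A (ltW r0)) (cone0 A) (g' := fun=> 0) hg.
move=> /(@psd_qform3 R B (fun i j => Phi (star (g i) * scal A r * g j))).
move=> /(_ 1 (- (k / r%:C) *: (1 : B)) 0); rewrite /g /=.
have -> : star 1 * scal A r * w = alpha *: (1 : A).
  by rewrite star1 mul1r scal_mul wE; module_field.
have -> : star w * scal A r * 1 = k *: (1 : A).
  by rewrite mulr1 mul_scal sw; module_field.
have -> : star w * scal A r * w = scal A r.
  rewrite mul_scal sw wE !scale_mull scale_mulr mulr1 !scalerA; congr (_ *: _).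
  by rewrite -[RHS](mulfK rC) -ak; field.
rewrite star1 star0 !(mul1r, mulr1, mul0r, mulr0, addr0) fa fk.
have -> : star (- (k / r%:C) *: (1 : B)) = - (alpha / r%:C) *: (1 : B).
  rewrite starZ star1 -[in RHS]kk; congr (_ *: _).
  rewrite rmorphN rmorphM; congr (- (_ * _)).
  by rewrite fmorphV /= conj_Creal // complex_real.
rewrite !(scale_mull, scale_mulr, mul1r, mulr1, star1) => h.
have r2 : 0 <= (2 * r)^-1 by rewrite invr_ge0 mulr_ge0 // ltW.
have := coneZ r2 h; congr cone; rewrite slope01.
have kak : k * alpha = r%:C * r%:C by rewrite mulrC.
have an : alpha != 0.
  by apply: contraTneq rC => a0; rewrite -ar a0 normr0 eqxx.
have kE' : k = r%:C * r%:C / alpha by rewrite -kak mulfK.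
by rewrite kE'; module_field.
Qed.

Lemma fixes_inv s : 1 < s -> fixes s -> fixes s^-1 /\ fixes (s^-1 ^+ 2).
Proof.
move=> s1 fs; have s0 : 0 < s by lra.
have i01 : 0 < s^-1 < 1 by rewrite invr_gt0 s0 invf_lt1.
suff /(slope_fixed_small i01) [h1 h2] : cone (slope 0 1 s^-1 - 1).
  by split; apply: Phi_fixed_of_slope; rewrite ?exprn_gt0 ?invr_gt0.
have := slope_sqrt_convex s0; rewrite (slope_of_Phi_fixed s0 fs).
by congr cone; module_ring.
Qed.

Lemma Phi_scale_fixes r a : 0 <= r -> fixes r -> fixes (r ^+ 2) ->
  Phi (r%:C *: a) = r%:C *: Phi a.
Proof.
move=> r0 fr fr2; apply: Phi_scale_of_fixed => //.
by rewrite ger0_norm ?ler0c // -rmorphXn.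
Qed.

(** Multiplication by powers of [r] carries the bound on the slopes for [t <= 1] to
    all [t > 0]. Then slopes are at most [1] for [t] and for [1 / t], while the sum of
    these two is at least [2] by convexity. *)
Lemma fixes_all r : 0 < r < 1 -> fixes r -> fixes (r ^+ 2) ->
  forall t, 0 < t -> fixes t.
Proof.
move=> /andP[r0 r1] fr fr2.
have rX n a : Phi ((r ^+ n)%:C *: a) = (r ^+ n)%:C *: Phi a.
  elim: n => [|n IH]; first by rewrite !expr0 !scale1r.
  rewrite exprS rmorphM -!scalerA (Phi_scale_fixes _ (ltW r0) fr fr2).
  by rewrite IH.
have bound t : 0 < t -> cone (scal B 2 - slope 0 1 t).
  move=> t0; have r01 : 0 <= r < 1 by rewrite ltW.
  have [n hn] := exists_geometric_le t r01 ltr01.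
  have rn0 : 0 < r ^+ n by rewrite exprn_gt0.
  have tr : 0 < t * r ^+ n <= 1 by rewrite hn mulr_gt0.
  have := slope_le2 tr; congr (cone (_ - _)); rewrite !slope01.
  rewrite mulrC rmorphM -scalerA rX.
  have rn : r ^+ n != 0 by rewrite gt_eqF.
  have tn : t != 0 by rewrite gt_eqF.
  by move: (r ^+ n) rn => q qn; module_field.
have le1 t : 0 < t -> cone (1 - slope 0 1 t).
  move=> t0; have := slope_geometric_decreasing (cone0 A) (cone1 A) t0 ltr01 (m := scal B 2).
  rewrite slope1 mul1r; apply=> n; apply: bound.
  by rewrite mul1r exprn_gt0.
move=> t t0; apply: Phi_fixed_of_slope => //.
apply/eqP; rewrite -subr_eq0; apply/eqP; apply: cone_antisym.
  have ti : 0 < t^-1 by rewrite invr_gt0.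
  have := coneD (slope_sqrt_convex t0) (le1 _ ti); congr cone; module_ring.
by rewrite opprB; apply: le1.
Qed.

Lemma fixes_pos (alpha : R[i]) : `|alpha| <= 1 \/ 0 <= alpha ->
  `|alpha| <> 0 -> `|alpha| <> 1 ->
  Phi (alpha *: (1 : A)) = alpha *: (1 : B) -> forall t, 0 < t -> fixes t.
Proof.
move=> dom an0 an1 fa.
have [s sE] : exists s : R, `|alpha| = s%:C.
  by exists (complex.Re `|alpha|); rewrite RRe_real // normr_real.
have s0 : 0 < s.
  rewrite lt_def -ler0c -sE normr_ge0 andbT; apply/eqP => se.
  by apply: an0; rewrite sE se.
have [s1|s1|s1] := ltgtP s 1; last by case: an1; rewrite sE s1.
- have s01 : 0 < s < 1 by rewrite s0.
  by have [] := fixes_norm sE s01 fa; apply: fixes_all.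
- have aE : alpha = s%:C.
    rewrite -sE ger0_norm //; case: dom => //.
    by rewrite sE -[1]/(1%:C) lecR leNgt s1.
  have fs : fixes s by rewrite /fixes -aE.
  have i01 : 0 < s^-1 < 1 by rewrite invr_gt0 s0 invf_lt1.
  by have [] := fixes_inv s1 fs; apply: fixes_all.
Qed.

Lemma Phi_scale (alpha : R[i]) : `|alpha| <= 1 \/ 0 <= alpha ->
  Phi (alpha *: (1 : A)) = alpha *: (1 : B) ->
  forall a, Phi (alpha *: a) = alpha *: Phi a.
Proof.
move=> dom fa a; have [a0|/eqP an0] := eqVneq `|alpha| 0.
  by move/normr0_eq0: a0 => ->; rewrite !scale0r.
apply: Phi_scale_of_fixed => //.
have [->|/eqP an1] := eqVneq `|alpha| 1; first by rewrite expr1n !scale1r.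
have [s sE] : exists s : R, `|alpha| = s%:C.
  by exists (complex.Re `|alpha|); rewrite RRe_real // normr_real.
rewrite sE -rmorphXn; apply: (fixes_pos dom an0 an1 fa).
rewrite exprn_even_gt0 //=; apply/eqP => s0.
by apply: an0; rewrite sE s0.
Qed.

Lemma Phi_homogeneous : (forall t, 0 < t -> fixes t) ->
  forall t a, 0 < t -> Phi (t%:C *: a) = t%:C *: Phi a.
Proof.
move=> fix_all t a t0; apply: Phi_scale_fixes; first exact: ltW.
  exact: fix_all.
by apply: fix_all; rewrite exprn_gt0.
Qed.

(** * Additivity on the positive cone *)
Section Additivity.
Hypothesis Phi_continuous : continuous Phi.
Hypothesis Phi_homog :
  forall t a, 0 < t -> Phi (t%:C *: a) = t%:C *: Phi a.

Lemma Phi_limit a b d : 0 < d ->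
  exists2 e, 0 < e & forall t, 0 < t <= e -> nr (Phi (a + t%:C *: b) - Phi a) <= d.
Proof.
move=> d0; have dC : 0 < d%:C :> R[i] by rewrite -[0]/(0%:C) ltcR.
have /cvgrPdist_le/(_ _ dC) : Phi x @[x --> a] --> Phi a := @Phi_continuous a.
move=> /nbhs_normP [r /= r0 hr].
have rr : r = (complex.Re r)%:C by rewrite RRe_real // gtr0_real.
have r0' : 0 < complex.Re r by rewrite -ltcR -rr.
have N0 : 0 < nr b + 1 by have := nr_ge0 b; lra.
exists (complex.Re r / (nr b + 1) / 2); first by rewrite !divr_gt0.
move=> t /andP[t0 te]; rewrite nrB -lecR -nrE; apply: hr.
rewrite /ball_ /= opprD addrA subrr add0r normrN rr nrE ltcR nrZ_ge0 ?ltW //.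
have tN : t * (nr b + 1) <= complex.Re r / 2.
  by rewrite -ler_pdivlMr // mulrAC.
have : 0 <= nr b := nr_ge0 b; nra.
Qed.

(** Superadditivity and homogeneity, for [(1 + x / d) a] written as the sum of
    [(x / d) (a - d b)] and [a + x b], bound the slope at [x] by
    [(Phi a - Phi (a - d b)) / d]. So the slope is constant, that is,
    [Phi (b + e a) = e Phi a + slope] for [e > 0]; let [e] tend to [0]. *)
Lemma Phi_additive_dominated a b d : cone a -> cone b -> 0 < d ->
  cone (a - d%:C *: b) -> Phi (a + b) = Phi a + Phi b.
Proof.
move=> ca cb d0 cab; have dn : d != 0 by rewrite gt_eqF.
have bound x : 0 < x ->
    cone ((d^-1)%:C *: (Phi a - Phi (a - d%:C *: b)) - slope a b x).
  move=> x0; have xn : x != 0 by rewrite gt_eqF.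
  have xd0 : 0 < x / d by rewrite divr_gt0.
  have xd1 : 0 < 1 + x / d by lra.
  have c1 : cone ((x / d)%:C *: (a - d%:C *: b)) by apply: coneZ => //; exact: ltW.
  have c2 : cone (a + x%:C *: b) by apply: coneD => //; apply: coneZ => //; exact: ltW.
  have := Phi_superadditive c1 c2.
  have -> : (x / d)%:C *: (a - d%:C *: b) + (a + x%:C *: b) = (1 + x / d)%:C *: a.
    by module_field.
  rewrite !Phi_homog // => h.
  have xi : 0 <= x^-1 by rewrite invr_ge0 ltW.
  by have := coneZ xi h; congr cone; rewrite /slope; module_field.
have dec x y : 0 < x -> 0 < y -> cone (slope a b x - slope a b y).
  move=> x0 y0; have yx : 0 < y / x by rewrite divr_gt0.
  have xn : x != 0 by rewrite gt_eqF.
  have := slope_geometric_decreasing ca cb yx x0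
    (m := (d^-1)%:C *: (Phi a - Phi (a - d%:C *: b))).
  rewrite [x * _]mulrC divfK //; apply=> n; apply: bound.
  by rewrite mulr_gt0 // exprn_gt0.
have const x : 0 < x -> slope a b x = slope a b 1.
  move=> x0; apply/eqP; rewrite -subr_eq0; apply/eqP; apply: cone_antisym.
    exact: dec.
  by rewrite opprB; apply: dec.
have sl1 : slope a b 1 = Phi (a + b) - Phi a.
  by rewrite /slope invr1 !scale1r.
have line e : 0 < e -> Phi (b + e%:C *: a) = e%:C *: Phi a + slope a b 1.
  move=> e0; have en : e != 0 by rewrite gt_eqF.
  have ei : 0 < e^-1 by rewrite invr_gt0.
  rewrite -(const _ ei) /slope.
  have -> : b + e%:C *: a = e%:C *: (a + (e^-1)%:C *: b) by module_field.
  by rewrite Phi_homog //; module_field.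
have -> : Phi (a + b) = Phi a + slope a b 1 by rewrite sl1; module_ring.
congr (_ + _); apply/eqP; rewrite -subr_eq0; apply/eqP.
apply: (@nr_eq0_small _ _ _ 2) => // e e0.
have [d' d'0 hd'] := Phi_limit b a e0.
have N0 : 0 < nr (Phi a) + 1 by have := nr_ge0 (Phi a); lra.
pose t := Num.min d' (e / (nr (Phi a) + 1)).
have t0 : 0 < t by rewrite lt_min d'0 divr_gt0.
have td : 0 < t <= d' by rewrite t0 ge_min lexx.
have tN : t * (nr (Phi a) + 1) <= e.
  by rewrite -ler_pdivlMr // ge_min lexx orbT.
have := hd' _ td; rewrite line // => h.
rewrite [X in nr X](_ : _ = (t%:C *: Phi a + slope a b 1 - Phi b) - t%:C *: Phi a);
  last by module_ring.
have := nrD (t%:C *: Phi a + slope a b 1 - Phi b) (- (t%:C *: Phi a)).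
rewrite nrN (nrZ_ge0 _ (ltW t0)).
move: tN; rewrite mulrDr mulr1; nr_lra.
Qed.

(** [a + e b] dominates [e b], so the previous lemma applies to it; let [e] tend to
    [0]. *)
Lemma Phi_additive a b : cone a -> cone b -> Phi (a + b) = Phi a + Phi b.
Proof.
move=> ca cb.
have step e : 0 < e ->
    Phi (a + b + e%:C *: b) = Phi (a + e%:C *: b) + Phi b.
  move=> e0; rewrite -(@Phi_additive_dominated _ _ e) ?addrK //.
    by congr (Phi _); module_ring.
  by apply: coneD => //; apply: coneZ => //; exact: ltW.
apply/eqP; rewrite -subr_eq0; apply/eqP.
apply: (@nr_eq0_small _ _ _ 2) => // d d0.
have [e1 e10 h1] := Phi_limit (a + b) b d0.
have [e2 e20 h2] := Phi_limit a b d0.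
pose t := Num.min e1 e2; have t0 : 0 < t by rewrite lt_min e10.
have := h1 t; rewrite t0 ge_min lexx => /(_ isT).
have := h2 t; rewrite t0 ge_min lexx orbT => /(_ isT).
rewrite step // => l2 l1.
rewrite [X in nr X](_ : _ = (Phi (a + t%:C *: b) - Phi a) -
   (Phi (a + t%:C *: b) + Phi b - Phi (a + b))); last by module_ring.
have := nrD (Phi (a + t%:C *: b) - Phi a)
   (- (Phi (a + t%:C *: b) + Phi b - Phi (a + b))).
rewrite nrN; nr_lra.
Qed.

End Additivity.

End NonlinearMap.

Theorem lemma4p3 (R : realType) (A B : cstarAlgType R) (Phi : A -> B)
    (Phi_continuous : continuous Phi) (Phi_unital : Phi 1 = 1)
    (Phi_3positive : n_positive 3 Phi) (Phi_Smonp2 : Smonp 2 Phi)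
    (Phi0 : Phi 0 = 0) :
  (forall alpha : R[i], `|alpha| <= 1 \/ 0 <= alpha ->
     Phi (alpha *: (1 : A)) = alpha *: (1 : B) ->
     forall a : A, Phi (alpha *: a) = alpha *: Phi a)
  /\
  (forall alpha : R[i], `|alpha| <= 1 \/ 0 <= alpha ->
     `|alpha| <> 0 -> `|alpha| <> 1 ->
     Phi (alpha *: (1 : A)) = alpha *: (1 : B) ->
     forall (beta : R[i]) (a b : A), 0 <= beta -> positive a -> positive b ->
       Phi (beta *: a + b) = beta *: Phi a + Phi b).
Proof.
split; first exact: Phi_scale.
move=> alpha dom an0 an1 fa beta a b beta0 /positiveP ca /positiveP cb.
have homog : forall t c, 0 < t -> Phi (t%:C *: c) = t%:C *: Phi c.
  exact: Phi_homogeneous (fixes_pos _ _ _ _ dom an0 an1 fa).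
have [t tE] : exists t : R, beta = t%:C.
  by exists (complex.Re beta); rewrite RRe_real // ger0_real.
have t0 : 0 <= t by rewrite -ler0c -tE.
rewrite tE.
have -> : Phi (t%:C *: a + b) = Phi (t%:C *: a) + Phi b.
  by apply: Phi_additive => //; apply: coneZ.
have [->|tn] := eqVneq t 0; first by rewrite !scale0r Phi0.
by rewrite homog // lt_def tn.
Qed.
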